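(* Let $m\in\{1,2\}$, let $P$ be a cycle which exhibits an over-twist pattern of modality $m$, and let $f:[0,1]\to[0,1]$ be the $P$-linear map. If $m=2$, then there exist a $(4,2)$-IET $T:[0,1]\to[0,1]$ and a cycle $Q$ of $T$ such that $f|_P$ is conjugate to $T|_Q$. If $m=1$, then there exist a $(3,2)$-IET $T:[0,1]\to[0,1]$ and a cycle $Q$ of $T$ such that $f|_P$ is conjugate to $T|_Q$.
   Context: **Cycles and patterns.** A cycle (periodic orbit) of a map $f$ is a finite set $P$ cyclically permuted by $f$; its period is its cardinality. If $P=\{x_1<\dots<x_q\}$, its associated cyclic permutation is the $\sigma$ with $f(x_i)=x_{\sigma(i)}$. Two cycles are equivalent if they have the same associated cyclic permutation; equivalence classes are called patterns, and a cycle exhibits the pattern it belongs to. A pattern $\pi$ forces a pattern $\mu$ if every continuous interval map having a cycle that exhibits $\pi$ also has a cycle that exhibits $\mu$. **Over-rotation number.** For a cycle $P$ of period $q>1$ of a continuous interval map $f$, let $l$ be the number of points $x\in P$ such that $f(x)-x$ and $f^2(x)-f(x)$ have different signs. The over-rotation number of $P$ is $\frac{l}{2q}$. It depends only on the pattern of $P$, so it is also defined for patterns. A pattern is over-twist if it does not force any other pattern with the same over-rotation number. **$P$-linear map.** If $P$ is a cycle with leftmost point $c$ and rightmost point $d$, the $P$-linear map is the map $[c,d]\to[c,d]$ that agrees with the given map on $P$ and is affine on each component of $[c,d]\setminus P$. Here the leftmost and rightmost points of $P$ are $0$ and $1$. **Modality.** The lap count of a piecewise monotone map $f:[0,1]\to[0,1]$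 is the smallest number of subintervals into which $[0,1]$ can be subdivided so that $f$ is monotone on each. The modality of $f$ is its lap count minus one (modality 1: unimodal; modality 2: bimodal). The modality of a cycle $P$, and of the pattern it exhibits, is the modality of the $P$-linear map. **Interval exchange transformations.** An $(n,k)$-IET is a map $T:[0,1]\to[0,1]$ for which there are points $0=x_0<x_1<\dots<x_n=1$ (separation points) such that $T$ restricted to each $I_j=[x_j,x_{j+1})$, $0\leqslant j\leqslant n-1$ (the intervals, or segments, of isometry), is affine with slope $\pm1$, precisely $k$ of the $I_j$ have slope $-1$, and $T$ is bijective up to its values at endpoints, i.e. $T$ is injective on $[0,1]\setminus\{x_0,\dots,x_n\}$. **Conjugacy.** $f|_P$ is conjugate to $T|_Q$ if there is an order-preserving bijection $\psi:P\to Q$ with $\psi\circ f=T\circ\psi$ on $P$. *)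

(* Defs.v *)
From HB Require Import structures.
From mathcomp Require Import all_boot all_order all_algebra all_fingroup.
From mathcomp Require Import finmap.
From mathcomp Require Import all_classical all_reals all_analysis.

Set Implicit Arguments.
Unset Strict Implicit.
Unset Printing Implicit Defensive.

Import Order.TTheory GRing.Theory Num.Theory.
Import numFieldNormedType.Exports.

Local Open Scope classical_set_scope.
Local Open Scope ring_scope.

(* Every map of an interval `[a, b] into itself is represented by a total
   function R -> R; its values outside `[a, b] are irrelevant. *)
Definition interval_map (R : realType) (a b : R) (f : R -> R) : Prop :=
  [/\ a < b,
      {within `[a, b], continuous f} &
      {in `[a, b], forall x, f x \in `[a, b]}].

(* A finite set is cyclically permuted by f when f maps it onto itself and
   acts transitively on it. *)
Definition periodic_orbit (R : realType) (a b : R) (f : R -> R)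
    (P : {fset R}) : Prop :=
  [/\ P != fset0,
      {subset P <= `[a, b]},
      f @` [set` P] = [set` P] &
      {in P &, forall x y, exists n, iter n f x = y}].

(* Since a cycle is determined up to equivalence by its cyclic permutation,
   a pattern is represented by that permutation, with points indexed from 0. *)
Record pattern := Pattern {
  period : nat;
  pattern_perm :> 'S_period;
  pattern_cyclic : #|porbits pattern_perm| == 1%N
}.

Definition points (R : realType) (P : {fset R}) : seq R :=
  sort <=%R (enum_fset P).

Definition exhibits (R : realType) (f : R -> R) (P : {fset R})
    (p : pattern) : Prop :=
  #|` P| = period p /\
  forall i : 'I_(period p), f (points P)`_i = (points P)`_(p i).

Definition forces (R : realType) (p q : pattern) : Prop :=
  forall (a b : R) (f : R -> R), interval_map a b f ->
    (exists2 P, periodic_orbit a b f P & exhibits f P p) ->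
    (exists2 Q, periodic_orbit a b f Q & exhibits f Q q).

(* Meaningful for cycles of period > 1. *)
Definition over_rotation (R : realType) (f : R -> R) (P : {fset R}) : rat :=
  #|` [fset x in P | Num.sg (f x - x) != Num.sg (f (f x) - f x)]%fset|%:R
  / (2 * #|` P|)%:R.

(* The over-rotation number of any cycle exhibiting p; see
   [over_rotation_exhibits]. *)
Definition pattern_over_rotation (p : pattern) : rat :=
  #|[set i : 'I_(period p) | (i < p i)%N != (p i < p (p i))%N]%SET|%:R
  / (2 * period p)%:R.

(* Over-rotation numbers are defined for periods > 1 only. *)
Definition over_twist (R : realType) (p : pattern) : Prop :=
  (1 < period p)%N /\
  forall q : pattern, (1 < period q)%N -> forces R p q ->
    pattern_over_rotation q = pattern_over_rotation p -> q = p.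

(* f is the P-linear map of the cycle P of g; affinity is required on the
   closure [x, y] of each gap, so that f interpolates g linearly. *)
Definition P_linear (R : realType) (g : R -> R) (P : {fset R})
    (f : R -> R) : Prop :=
  {in P, f =1 g} /\
  forall x y, x \in P -> y \in P -> x < y ->
    (forall z, z \in P -> ~~ (x < z < y)) ->
    forall t, t \in `[0, 1] ->
      f ((1 - t) * x + t * y) = (1 - t) * f x + t * f y.

Definition subdivision (R : realType) (n : nat) (x : nat -> R) : Prop :=
  [/\ x 0%N = 0, x n = 1 & forall i, (i < n)%N -> x i < x i.+1].

Definition monotone_on (R : realType) (f : R -> R) (A : set R) : Prop :=
  {in A &, {homo f : x y / x <= y}} \/ {in A &, {homo f : x y /~ x <= y}}.

Definition piecewise_monotone (R : realType) (f : R -> R) (n : nat) : Prop :=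
  exists2 x : nat -> R, subdivision n x &
    forall i, (i < n)%N -> monotone_on f `[x i, x i.+1].

Definition lap_count (R : realType) (f : R -> R) (n : nat) : Prop :=
  piecewise_monotone f n /\
  forall k, piecewise_monotone f k -> (n <= k)%N.

Definition modality (R : realType) (f : R -> R) (m : nat) : Prop :=
  lap_count f m.+1.

(* x lists the separation points and F is the set of indices of the intervals
   of isometry with slope -1. *)
Definition IET (R : realType) (n k : nat) (T : R -> R) : Prop :=
  {in `[0, 1], forall t, T t \in `[0, 1]} /\
  exists (x : nat -> R) (F : {set 'I_n}) (c : 'I_n -> R),
    [/\ subdivision n x,
        #|F| = k,
        forall (j : 'I_n) t, t \in `[x j, x j.+1[ ->
          T t = (-1) ^+ (j \in F) * t + c j &
        set_inj (`[0, 1] `\` [set x i | i in `I_n.+1]) T].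

Definition conjugate_on (R : realType) (f : R -> R) (P : {fset R})
    (T : R -> R) (Q : {fset R}) : Prop :=
  exists psi : R -> R,
    [/\ set_bij [set` P] [set` Q] psi,
        {in P &, {homo psi : x y / x <= y}} &
        {in P, forall x, psi (f x) = T (psi x)}].

Section OverRotationExhibits.
Variables (R : realType) (f : R -> R) (P : {fset R}) (p : pattern).
Hypothesis fPp : exhibits f P p.

Let xs := points P.

Let size_xs : size xs = period p.
Proof. by rewrite size_sort; case: fPp. Qed.

Let mem_xs : xs =i P.
Proof. by move=> x; rewrite mem_sort. Qed.

Let nth_lt (i j : 'I_(period p)) : (xs`_i < xs`_j) = (i < j)%N.
Proof.
have xs_sorted : sorted <%R xs.
  by rewrite lt_sorted_uniq_le sort_uniq fset_uniq sort_le_sorted.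
by rewrite (lt_sorted_ltn_nth 0 xs_sorted) // inE size_xs.
Qed.

Let sg_nth (i j : 'I_(period p)) : i != j ->
  Num.sg (xs`_j - xs`_i) = (-1) ^+ (j < i)%N.
Proof.
move=> ij; have [ltij|ltji|/val_inj/eqP] := ltngtP i j; last by rewrite (negPf ij).
- by rewrite gtr0_sg ?subr_gt0 ?nth_lt // expr0.
- by rewrite ltr0_sg ?subr_lt0 ?nth_lt // expr1.
Qed.

Let p_moves : (1 < period p)%N -> forall i, i != p i.
Proof.
move=> q_gt1 i; apply/eqP => ipi.
have /cards1P[Op PO] := pattern_cyclic p.
have porbE j : porbit p j = Op.
  by apply/set1P; rewrite -PO imset_f.
have Oi : Op = [set i]%SET.
  rewrite -(porbE i); apply/setP => j; rewrite inE; apply/idP/eqP => [|->].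
    case/porbitP => n ->; elim: n => [|n IHn]; first by rewrite expg0 perm1.
    by rewrite expgSr permM IHn -ipi.
  exact: porbit_id.
have all_i j : j = i.
  by apply/set1P; rewrite -Oi -(porbE j) porbit_id.
have := all_i (Ordinal q_gt1); have := all_i (Ordinal (ltnW q_gt1)).
by move=> <- /(congr1 val).
Qed.

Lemma over_rotation_exhibits : (1 < period p)%N ->
  over_rotation f P = pattern_over_rotation p.
Proof.
move=> q_gt1; have [cardP fE] := fPp; rewrite /over_rotation cardP.
congr (_%:R / _); rewrite cardE -(size_map (fun i : 'I_(period p) => xs`_i)).
apply/perm_size/uniq_perm; first exact: fset_uniq.
  rewrite map_inj_uniq ?enum_uniq // => i j eq_ij; apply/val_inj.
  by have [||//] := ltngtP i j; rewrite -nth_lt eq_ij ltxx.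
have nthE (i : 'I_(period p)) :
    (Num.sg (f xs`_i - xs`_i) != Num.sg (f (f xs`_i) - f xs`_i)) =
    ((i < p i)%N != (p i < p (p i))%N).
  rewrite !fE !sg_nth ?p_moves // (inj_eq (@signr_inj _)).
  have ltNC (u v : 'I_(period p)) : u != v -> (v < u)%N = ~~ (u < v)%N.
    by move=> uv; have [//|//|/val_inj/eqP] := ltngtP u v; rewrite (negPf uv).
  by rewrite (ltNC i (p i)) ?(ltNC (p i) (p (p i))) ?p_moves // (inj_eq negb_inj).
move=> x; rewrite !inE; apply/andP/mapP => [[Px sgx]|[i]].
  have xP : x \in xs by rewrite mem_xs.
  have ix : (index x xs < period p)%N by rewrite -size_xs index_mem.
  exists (Ordinal ix); last by rewrite /= nth_index.
  by rewrite mem_enum inE -nthE /= nth_index.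
rewrite mem_enum inE -nthE => sgi ->; split=> //.
by rewrite -mem_xs mem_nth // size_xs.
Qed.

End OverRotationExhibits.

(* Main.v *)
(** Let b/q, in lowest terms, be the over-rotation number of the pattern p.
Reversing the part of the interval on the right of a fixed point turns the
interval into a circle, on which a slow cycle advances monotonically.  The
patterns obtained in this way from the rotation by b on q points, of which A lie
on the left of the fixed point, have over-rotation number b/q, and they are the
patterns of cycles of interval exchanges with slopes +1, -1, -1, +1.

If p has at most three laps, then p forces one of these rotation patterns, so an
over-twist p is equal to it.  To find A, give each point of the cycle its phase:
the number of steps times b, minus q times the number of turns.  Then A is the
difference between the minimal phases on the right and on the left.  The points
which are furthest along the circle among those of bounded phase bound a chain
of q intervals, each covering the next one; a Knaster-Tarski argument on
monotone q-tuples gives a cycle through them, whose points are ordered as in the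
rotation.  When the points moving right do not all lie on the left of those
moving left, a horseshoe gives the chain directly.  If b/q = 1/2, p forces the
cycle of period 2, whose modality is 0. *)

Require Import Defs.
From HB Require Import structures.
From mathcomp Require Import all_boot all_order all_algebra all_fingroup.
From mathcomp Require Import finmap.
From mathcomp Require Import all_classical all_reals all_analysis.
From mathcomp Require Import zify ring lra.

Set Implicit Arguments.
Unset Strict Implicit.
Unset Printing Implicit Defensive.

Import Order.TTheory GRing.Theory Num.Theory.
Import numFieldNormedType.Exports.

Local Open Scope classical_set_scope.
Local Open Scope ring_scope.

(** * Cycles from chains of coverings *)

(** Composing [g] with the retraction of the line onto [[a, b]] trades continuity on a subspace for
    continuity everywhere. *)
Lemma continuous_extension (R : realType) (a b : R) (g : R -> R) :
  a <= b -> {within `[a, b], continuous g} ->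
  exists2 G : R -> R, continuous G & {in `[a, b], G =1 g}.
Proof.
move=> leab /subspace_continuousP g_cont.
pose c (t : R) := Num.max a (Num.min b t).
have c_in t : c t \in `[a, b].
  by rewrite in_itv /= le_max lexx /= ge_max leab ge_min lexx.
have c_id t : t \in `[a, b] -> c t = t.
  by rewrite in_itv /= => /andP[at_ tb]; rewrite /c (min_idPr tb) (max_idPr at_).
exists (g \o c); last by move=> t /c_id ct; rewrite /= ct.
move=> t; have c_cont : {for t, continuous c}.
  apply: (@continuous_max _ _ (fun=> a) (fun t => Num.min b t)).
    exact: cst_continuous.
  by apply: (@continuous_min _ _ (fun=> b) id); [exact: cst_continuous|exact: cvg_id].
move=> U gU; have := c_cont _ (g_cont (c t) (c_in t) U gU).
by apply: (@filterS _ (nbhs t)) => u /=; apply; exact: c_in.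
Qed.

Lemma continuous_last_point (R : realType) (phi : R -> R) (e d v : R) :
  continuous phi -> e <= d -> phi e <= v <= phi d ->
  exists w, [/\ e <= w <= d, phi w = v &
    forall t, e <= t <= d -> phi t <= v -> t <= w].
Proof.
move=> phi_cont led /andP[phie phid].
pose A := `[e, d] `&` phi @^-1` [set x | x <= v].
have A_compact : compact A.
  apply: (subclosed_compact _ (@segment_compact _ e d)); last exact: subIsetl.
  apply: closedI; first exact: interval_closed.
  by apply: closed_comp => [x _|]; [exact: phi_cont|exact: closed_le].
have A0 : A !=set0 by exists e; split; rewrite //= in_itv /= lexx.
have [w] := compact_EVT_max A0 A_compact
  (continuous_subspaceT (fun x : R => @cvg_id _ (nbhs x))).
rewrite inE => -[/= wed phiw] w_max; exists w.
have {}w_max t : e <= t <= d -> phi t <= v -> t <= w.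
  by move=> ted phit; apply: w_max; rewrite inE; split; rewrite //= in_itv.
rewrite in_itv /= in wed; split => //; apply/eqP; rewrite eq_le phiw /=.
have [_ wd] := andP wed.
have [|u] := @IVT _ phi w d v wd (continuous_subspaceT phi_cont).
  by rewrite ge_min phiw le_max phid orbT.
rewrite in_itv /= => /andP[wu ud] phiu.
have : u <= w by apply: w_max; rewrite ?phiu // ud (le_trans _ wu) //; case/andP: wed.
by move=> uw; rewrite -phiu; have -> : w = u by apply/le_anti; rewrite wu uw.
Qed.

(* Tarski: the infimum of the tuples Z such that [phi i t <= Z (s i)] forces
   [t <= Z i] is fixed by [Z |-> (last t with phi i t = Z (s i))_i]. *)
Lemma monotone_loop (R : realType) (I : Type) (s : I -> I) (e d : I -> R)
    (phi : I -> R -> R) (C : I -> I -> Prop) :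
  (forall i, continuous (phi i)) -> (forall i, e i <= d i) ->
  (forall i, phi i (e i) <= e (s i)) -> (forall i, d (s i) <= phi i (d i)) ->
  (forall i j, C i j -> d i <= e j \/
     [/\ phi i = phi j, e i <= e j, d i <= d j & C (s i) (s j)]) ->
  exists Y : I -> R, [/\ forall i, e i <= Y i <= d i,
    forall i, phi i (Y i) = Y (s i) & forall i j, C i j -> Y i <= Y j].
Proof.
move=> phi_cont led phie phid C_or.
pose box (Z : I -> R) := (forall i, e i <= Z i <= d i) /\
  (forall i j, C i j -> Z i <= Z j).
pose S (Z : I -> R) := box Z /\ forall i t, e i <= t <= d i ->
  phi i t <= Z (s i) -> t <= Z i.
have Sd : S d.
  split=> [|i t /andP[]//]; split=> [i|i j /C_or[|[]//]]; first by rewrite led lexx.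
  by move=> /le_trans; apply.
pose Y i := inf [set Z i | Z in S].
have YI Z i : S Z -> Y i <= Z i.
  move=> SZ; apply: ge_inf; last by exists Z.
  by exists (e i) => _ [Z' [[ZB _] _] <-]; case/andP: (ZB i).
have IY i v : (forall Z, S Z -> v <= Z i) -> v <= Y i.
  move=> vZ; apply: lb_le_inf; first by exists (d i); exists d.
  by move=> _ [Z SZ <-]; exact: vZ.
have SY : S Y.
  split; first split.
  - by move=> i; rewrite YI // andbT; apply: IY => Z [[/(_ i)/andP[]]].
  - move=> i j Cij; apply: IY => Z SZ; apply: le_trans (YI Z i SZ) _.
    by case: SZ => -[_ /(_ _ _ Cij)].
  - move=> i t ted phit; apply: IY => Z SZ; case: (SZ) => _; apply => //.
    exact: le_trans phit (YI _ _ SZ).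
have [[YB YC] Yt] := SY.
have Wex i : exists w, [/\ e i <= w <= d i, phi i w = Y (s i) &
    forall t, e i <= t <= d i -> phi i t <= Y (s i) -> t <= w].
  apply: continuous_last_point => //; have /andP[eY Yd] := YB (s i).
  by rewrite (le_trans (phie i)) // (le_trans Yd).
have /choice[W WP] := Wex.
have WY i : W i <= Y i by have [wed wv _] := WP i; apply: Yt; rewrite ?wv.
have SW : S W.
  split; first split.
  - by move=> i; case: (WP i).
  (* If the boxes are not already ordered, either [W i] is at most [e j], or it lies in the box of
     [j]. In the second case [phi j (W i) = Y (s i) <= Y (s j)], and [W j] is the last point with
     such a value. *)
  - move=> i j Cij; have [Wi phiWi _] := WP i; have [Wj _ Wmax] := WP j.
    have [ij|[eqphi eij dij Csij]] := C_or _ _ Cij.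
      by case/andP: Wi => _ /le_trans; apply; apply: le_trans ij _; case/andP: Wj.
    have [Wej|ejW] := leP (W i) (e j).
      by apply: le_trans Wej _; case/andP: Wj.
    apply: Wmax; first by rewrite ltW //= (le_trans _ dij) //; case/andP: Wi.
    by rewrite -eqphi phiWi; apply: YC.
  - move=> i t ted phit; have [_ _] := WP i; apply => //.
    exact: le_trans phit (WY _).
exists Y; split=> // i; have [_ <- _] := WP i; congr (phi i _).
by apply/le_anti; rewrite WY YI.
Qed.

(** * Cycles and their points *)

Lemma pattern_transitive (p : pattern) (i j : 'I_(period p)) :
  exists k, iter k p i = j.
Proof.
have /cards1P[B pB] := pattern_cyclic p.
have porbE k : porbit p k = B by apply/set1P; rewrite -pB imset_f.
have : j \in porbit p i by rewrite porbE -(porbE j) porbit_id.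
by case/porbitP => k ->; exists k; rewrite permX.
Qed.

Lemma period_gt0 (p : pattern) : (0 < period p)%N.
Proof.
have /cards1P[B pB] := pattern_cyclic p.
have : B \in porbits p by rewrite pB set11.
by case/imsetP => i _ _; apply: leq_ltn_trans (ltn_ord i).
Qed.

Lemma pattern_closed (p : pattern) (S : pred 'I_(period p)) (i j : 'I_(period p)) :
  (forall k, S k -> S (p k)) -> S i -> S j.
Proof.
move=> Sp Si; have [k <-] := pattern_transitive i j.
by elim: k => //= k; exact: Sp.
Qed.

Lemma pattern_not_fixed (p : pattern) (i : 'I_(period p)) :
  (1 < period p)%N -> p i != i.
Proof.
move=> p_gt1; apply/eqP => pii.
have all_i j : j = i.
  apply/eqP; apply: (@pattern_closed p (pred1 i) i j) => //= k /eqP ->.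
  exact/eqP.
have := all_i (Ordinal p_gt1); rewrite -(all_i (Ordinal (ltnW p_gt1))).
by move=> /(congr1 val).
Qed.

Lemma size_points (R : realType) (P : {fset R}) : size (points P) = #|` P|.
Proof. exact: size_sort. Qed.

Lemma mem_points (R : realType) (P : {fset R}) : points P =i P.
Proof. by move=> x; rewrite mem_sort. Qed.

Lemma nth_points_le (R : realType) (P : {fset R}) i j :
  (i < #|` P|)%N -> (j < #|` P|)%N ->
  ((points P)`_i <= (points P)`_j) = (i <= j)%N.
Proof.
move=> iP jP; have points_sorted : sorted <%R (points P).
  by rewrite lt_sorted_uniq_le sort_uniq fset_uniq sort_le_sorted.
by rewrite (lt_sorted_leq_nth 0 points_sorted) // inE size_points.
Qed.

Lemma nth_points_lt (R : realType) (P : {fset R}) i j :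
  (i < #|` P|)%N -> (j < #|` P|)%N ->
  ((points P)`_i < (points P)`_j) = (i < j)%N.
Proof. by move=> iP jP; rewrite !ltNge nth_points_le // -ltnNge. Qed.

Lemma exhibits_orbit (R : realType) (a b : R) (g : R -> R) (q : pattern)
    (y : 'I_(period q) -> R) :
  {homo y : i j / (i < j)%N >-> i < j} -> (forall i, y i \in `[a, b]) ->
  (forall i, g (y i) = y (q i)) ->
  exists Q : {fset R},
    [/\ periodic_orbit a b g Q, exhibits g Q q & [set` Q] = range y].
Proof.
move=> y_incr y_ab gy.
pose Q := [fset y i | i in 'I_(period q)]%fset.
have memQ x : (x \in Q) = (x \in codom y).
  apply/imfsetP/codomP => [[i _ ->]|[i ->]]; by exists i.
have pointsQ : points Q = codom y.
  apply: lt_sorted_eq => [||x].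
  - by rewrite lt_sorted_uniq_le sort_uniq fset_uniq sort_le_sorted.
  - rewrite sorted_map; apply: (@sub_sorted _ (relpre val ltn)) => [i j|].
      exact: y_incr.
    by rewrite -sorted_map val_enum_ord iota_ltn_sorted.
  - by rewrite mem_points memQ.
have setQ : [set` Q] = range y.
  apply/seteqP; split => [x /=|_ [i _ <-] /=]; rewrite memQ.
    by case/codomP => i ->; exists i.
  exact: codom_f.
exists Q; split=> //.
- split.
  + by apply/fset0Pn; exists (y (Ordinal (period_gt0 q))); rewrite memQ codom_f.
  + by move=> x; rewrite memQ => /codomP[i ->].
  + rewrite setQ; apply/seteqP; split => [_ [_ [i _ <-] <-]|_ [i _ <-]].
      by exists (q i).
    pose j := ((q : {perm _})^-1)%g i.
    by exists (y j); [exists j|rewrite gy permKV].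
  + move=> x z; rewrite !memQ => /codomP[i ->] /codomP[j ->].
    have [k <-] := pattern_transitive i j; exists k.
    by elim: k => //= k ->; rewrite gy.
- have nthQ (i : 'I_(period q)) : (points Q)`_i = y i.
    by rewrite pointsQ (nth_map i) ?size_enum_ord // nth_ord_enum.
  split=> [|i]; last by rewrite !nthQ gy.
  by rewrite -size_points pointsQ size_codom card_ord.
Qed.

(** * Rotation patterns *)

Section RotationPattern.
Variables (q b A : nat).
Local Open Scope nat_scope.

Definition circle_rot (i : 'I_q) : 'I_q :=
  Ordinal (ltn_pmod (i + b) (leq_ltn_trans (leq0n i) (ltn_ord i))).

Lemma flip_subproof (i : 'I_q) : (if i < A then i : nat else q.-1 + A - i) < q.
Proof. by have := ltn_ord i; case: (ltnP i A); lia. Qed.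

(* The numbering of the points along the circle: upwards on the left of the
   fixed point, then downwards on its right. *)
Definition circle_flip (i : 'I_q) : 'I_q := Ordinal (flip_subproof i).

Definition rotation_fun (i : 'I_q) : 'I_q :=
  circle_flip (circle_rot (circle_flip i)).

Lemma circle_flipK : involutive circle_flip.
Proof.
move=> i; apply/val_inj => /=; have := ltn_ord i.
by case: (ltnP i A) => [->//|iA] iq; case: ltnP; lia.
Qed.

Lemma circle_flip_lt (i : 'I_q) : (circle_flip i < A) = (i < A).
Proof. by have := ltn_ord i; rewrite /=; case: (ltnP i A) => // ? ?; lia. Qed.

Lemma circle_rot_inj : injective circle_rot.
Proof.
move=> i j /(congr1 val) /= /eqP; rewrite eqn_modDr !modn_small //.
by move/eqP/val_inj.
Qed.

Lemma iter_circle_rot k (i : 'I_q) : iter k circle_rot i = (i + k * b) %% q :> nat.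
Proof.
elim: k => [|k IHk]; first by rewrite mul0n addn0 modn_small.
by rewrite iterS /= IHk modnDml mulSnr addnA.
Qed.

Lemma circle_rot_transitive (i j : 'I_q) : 0 < b -> coprime b q ->
  exists k, iter k circle_rot i = j.
Proof.
move=> b0 /(coprimeP _ b0)[[u v] /= uv].
(* Bezout makes [u] an inverse of [b] modulo [q]. The summand [q] keeps the natural-number
   subtraction from truncating. *)
exists (u * (j + q - i)); apply/ord_inj; rewrite iter_circle_rot.
have -> : i + u * (j + q - i) * b = (v * (j + q - i) + 1) * q + j.
  have [iq jq] := (ltn_ord i, ltn_ord j); set d := j + q - i.
  have -> : u * d * b = (v * q + 1) * d.
    have -> : v * q + 1 = u * b by lia.
    by rewrite mulnAC.
  have -> : (v * q + 1) * d = v * d * q + d by ring.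
  by rewrite mulnDl mul1n /d; lia.
by rewrite modnMDl modn_small.
Qed.

Lemma val_circle_rot (i : 'I_q) : b <= q ->
  circle_rot i = (if i + b < q then i + b else i + b - q) :> nat.
Proof.
rewrite /= => bq; have := ltn_ord i; case: (ltnP (i + b)) => ib iq.
  by rewrite modn_small.
by rewrite -{1}(subnK ib) modnDr modn_small //; lia.
Qed.

Lemma rotation_fun_inj : injective rotation_fun.
Proof. exact: inj_comp (inj_comp (inv_inj circle_flipK) circle_rot_inj) (inv_inj circle_flipK). Qed.

Definition rotation_perm : 'S_q := perm rotation_fun_inj.

Lemma iter_rotation_perm k i :
  iter k rotation_perm i = circle_flip (iter k circle_rot (circle_flip i)).
Proof.
elim: k => [|k IHk] /=; first by rewrite circle_flipK.
by rewrite IHk permE /rotation_fun circle_flipK.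
Qed.

Hypotheses (b_gt0 : 0 < b) (cobq : coprime b q) (leAq : b <= A <= q - b).

Lemma rotation_perm_cyclic : #|porbits rotation_perm| == 1.
Proof.
have q_gt0 : 0 < q by lia.
apply/cards1P; exists (porbit rotation_perm (Ordinal q_gt0)).
apply/setP => B; rewrite inE; apply/imsetP/eqP => [[i _ ->]|->]; last by eexists.
apply/eqP; rewrite eq_porbit_mem; apply/porbitP.
have [k ki] := circle_rot_transitive (circle_flip (Ordinal q_gt0)) (circle_flip i) b_gt0 cobq.
by exists k; rewrite permX iter_rotation_perm ki circle_flipK.
Qed.

Definition rotation_pattern : pattern := Pattern rotation_perm_cyclic.

(** The four cases have slopes +1, -1, -1, +1: staying on the left, passing to the right, passing to
    the left, staying on the right. *)
Lemma val_rotation_perm (k : 'I_q) : rotation_perm k =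
  (if k < A - b then k + b else if k < A then q.-1 + A - b - k
   else if k < A + b then A + b - 1 - k else k - b) :> nat.
Proof.
rewrite permE /rotation_fun; set i := circle_flip k; set j := circle_rot i.
have jE : j = (if i + b < q then i + b else i + b - q) :> nat.
  by apply: val_circle_rot; lia.
have iE : i = (if k < A then k : nat else q.-1 + A - k) :> nat by [].
have -> : circle_flip j = (if j < A then j : nat else q.-1 + A - j) :> nat by [].
have kq := ltn_ord k; rewrite jE iE; case: (ltnP k A) => kA;
  case: (ltnP (_ + b) q) => iq; do ![case: ifP => ?]; lia.
Qed.

Lemma rotation_perm_up (k : 'I_q) : (k < rotation_perm k) = (k < A).
Proof.
have := ltn_ord k; rewrite val_rotation_perm.
case: (ltnP k A) => ?; do ![case: ifP => ?]; lia.
Qed.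

(** The direction of motion changes exactly on the [2 * b] consecutive indices from [A - b] to
    [A + b - 1], those which change sides. *)
Lemma rotation_over_rotation :
  pattern_over_rotation rotation_pattern = (b%:R / q%:R)%R.
Proof.
rewrite /pattern_over_rotation /=.
have shift_subproof (j : 'I_(2 * b)) : A - b + j < q by have := ltn_ord j; lia.
pose shift j := Ordinal (shift_subproof j).
have shift_inj : injective shift.
  by move=> i j /(congr1 val) /= /eqP; rewrite eqn_add2l => /eqP/val_inj.
have -> : [set i : 'I_q | (i < rotation_perm i) !=
    (rotation_perm i < rotation_perm (rotation_perm i))]%SET =
    [set shift j | j : 'I_(2 * b)].
  apply/setP => i; rewrite inE !rotation_perm_up val_rotation_perm.
  have iq := ltn_ord i; apply/idP/imsetP => [|[j _ ->]]; last first.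
    by have := ltn_ord j; rewrite /=; do ![case: ifP => ?]; lia.
  move=> iA; have jb : i - (A - b) < 2 * b.
    by move: iA; do ![case: ifP => ?]; lia.
  have {}iA : A - b <= i by move: iA; do ![case: ifP => ?]; lia.
  by exists (Ordinal jb) => //; apply/val_inj => /=; lia.
rewrite card_imset // card_ord !natrM -mulf_div divff ?mul1r //.
Qed.

End RotationPattern.

(** * Forced rotation patterns *)

(* A cyclic chain of q intervals, each covering the next one, with one endpoint
   e i in the cycle; the other endpoint is c1, c2 or a fixed point between s and
   s'.  G and B (green and black in the literature) mark the indices which stay
   on their side of the fixed point and those which change sides; L and R are
   the two sides. *)
Record rotation_cover (n : nat) (p : 'S_n) (q b A : nat) (e : 'I_q -> 'I_n)
    (c1 s s' c2 : 'I_n) : Prop := RotationCover {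
  cover_order : [&& c1 <= s, s < s' & s' <= c2]%N;
  cover_fixed : (s' <= p s)%N && (p s' <= s)%N;
  cover_turn : (s' <= p c1)%N && (p c2 <= s)%N;
  cover_GL : forall i : 'I_q, (i + b < A)%N ->
    (e i <= c1)%N && (p (e i) <= e (circle_rot b i))%N;
  cover_BL : forall i : 'I_q, (i < A <= i + b)%N ->
    (c1 <= e i <= s)%N && (e (circle_rot b i) <= p (e i))%N;
  cover_GR : forall i : 'I_q, (A <= i)%N && (i + b < q)%N ->
    (c2 <= e i)%N && (e (circle_rot b i) <= p (e i))%N;
  cover_BR : forall i : 'I_q, (q <= i + b)%N ->
    (s' <= e i <= c2)%N && (p (e i) <= e (circle_rot b i))%N;
  cover_monoL : forall i j : 'I_q, (i <= j < A)%N -> (e i <= e j)%N;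
  cover_monoR : forall i j : 'I_q, (A <= i <= j)%N -> (e j <= e i)%N
}.

Section CoverForces.
Variables (R : realType) (p : pattern) (q b A : nat).
Hypotheses (b_gt0 : (0 < b)%N) (cobq : coprime b q).
Hypotheses (leAq : (b <= A <= q - b)%N) (lt2b : (2 * b < q)%N).
Variables (e : 'I_q -> 'I_(period p)) (c1 s s' c2 : 'I_(period p)).
Hypothesis cover : rotation_cover p b A e c1 s s' c2.
Variables (lo hi : R) (g : R -> R) (P : {fset R}).
Hypotheses (P_sub : {subset P <= `[lo, hi]}) (P_exhibits : exhibits g P p).
Variable G : R -> R.
Hypotheses (G_cont : continuous G) (Gg : {in `[lo, hi], G =1 g}).

Let x (i : 'I_(period p)) : R := (points P)`_i.

Let x_in i : x i \in `[lo, hi].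
Proof.
apply: P_sub; rewrite -mem_points mem_nth // size_points.
by case: P_exhibits => ->.
Qed.

Let x_le i j : (x i <= x j) = (i <= j)%N.
Proof. by case: P_exhibits => cardP _; rewrite nth_points_le ?cardP. Qed.

Let x_lt i j : (x i < x j) = (i < j)%N.
Proof. by rewrite !ltNge x_le -ltnNge. Qed.

Let Gx i : G (x i) = x (p i).
Proof. by case: P_exhibits => _ gx; rewrite Gg ?x_in // gx. Qed.

Let le_c1s : (c1 <= s)%N. Proof. by case/and3P: (cover_order cover). Qed.
Let lt_ss' : (s < s')%N. Proof. by case/and3P: (cover_order cover). Qed.
Let le_s'c2 : (s' <= c2)%N. Proof. by case/and3P: (cover_order cover). Qed.

Let fixed_point : exists w, [/\ x s < w, w < x s' & G w = w].
Proof.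
have /andP[s'ps ps's] := cover_fixed cover.
have phi_cont : continuous (fun t => t - G t).
  by move=> t; apply: cvgB; [exact: cvg_id|exact: G_cont].
have [||w [/andP[sw ws'] /eqP]] :=
    @continuous_last_point _ (fun t => t - G t) (x s) (x s') 0 phi_cont.
- by rewrite ltW // x_lt.
- by rewrite !Gx subr_le0 subr_ge0 !x_le (leq_trans (ltnW lt_ss')) //= (leq_trans ps's) // ltnW.
rewrite subr_eq0 => /eqP wG _; exists w; split => //; rewrite lt_neqAle ?sw ?ws' andbT.
  apply/eqP => ws; move: wG; rewrite -ws Gx => /eqP.
  by rewrite eq_le !x_le; lia.
by apply/eqP => ws; move: wG; rewrite ws Gx => /eqP; rewrite eq_le !x_le; lia.
Qed.

Let rot (i : 'I_q) : 'I_q := circle_rot b i.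

Let rotE (i : 'I_q) : rot i = (if i + b < q then i + b else i + b - q)%N :> nat.
Proof. by apply: val_circle_rot; lia. Qed.

(* The tuple of [monotone_loop] is read with a sign on the right of w, so that
   it increases along the circle. *)
Let loop_exists w : x s < w -> w < x s' -> G w = w ->
  exists z : 'I_q -> R, [/\ forall i, G (z i) = z (rot i),
    forall i, z i \in `[lo, hi],
    forall i : 'I_q, if (i < A)%N then z i <= w else w <= z i,
    (forall i : 'I_q, (i + b < A)%N -> z i < w) /\
      (forall i : 'I_q, (A <= i)%N && (i + b < q)%N -> w < z i) &
    forall i j : 'I_q, (i <= j)%N -> (i < A)%N = (j < A)%N ->
      if (i < A)%N then z i <= z j else z j <= z i].
Proof.
move=> sw ws' Gw.
pose sgn (i : 'I_q) (t : R) := if (i < A)%N then t else - t.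
(* The interval of an index which stays on its side ends at [c1] or [c2], that of an index which
   changes sides at the fixed point [w]. In [phi i], the argument is read with the sign of [i] and
   the value with the sign of [rot i]. *)
pose d (i : 'I_q) : R := if (i + b < A)%N then x c1 else if (i < A)%N then w
  else if (i + b < q)%N then - x c2 else - w.
pose phi (i : 'I_q) : R -> R := if (i + b < A)%N then G
  else if (i < A)%N then fun t => - G t
  else if (i + b < q)%N then fun t => - G (- t) else fun t => G (- t).
have letterP (i : 'I_q) :
    [\/ (i + b < A)%N /\ [/\ (i + b < A)%N = true, (i < A)%N = true,
           (i + b < q)%N = true & (rot i < A)%N = true],
        (i < A <= i + b)%N /\ [/\ (i + b < A)%N = false, (i < A)%N = true,
           (i + b < q)%N = true & (rot i < A)%N = false],
        (A <= i)%N && (i + b < q)%N /\ [/\ (i + b < A)%N = false,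
           (i < A)%N = false, (i + b < q)%N = true & (rot i < A)%N = false] |
        (q <= i + b)%N /\ [/\ (i + b < A)%N = false, (i < A)%N = false,
           (i + b < q)%N = false & (rot i < A)%N = true]].
  have iq := ltn_ord i; rewrite rotE; case: (ltnP (i + b) q) => ibq.
    case: (ltnP (i + b) A) => iA; first by constructor 1; split; [|split]; lia.
    by case: (ltnP i A) => iA'; [constructor 2|constructor 3]; split; [|split| |split]; lia.
  by constructor 4; split; [|split]; lia.
have xc1w : x c1 < w by apply: le_lt_trans sw; rewrite x_le.
have wxc2 : w < x c2 by apply: lt_le_trans ws' _; rewrite x_le.
have dw i : d i <= sgn i w.
  by rewrite /d /sgn; do ![case: ifP => ?]; rewrite ?lerN2 ?(ltW xc1w) ?(ltW wxc2) //; lia.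
have GN_cont : continuous (fun t => G (- t)).
  by move=> t; apply: continuous_comp; [exact: opp_continuous|exact: G_cont].
have [] := @monotone_loop R _ rot (fun i => sgn i (x (e i))) d phi
  (fun i j => (i <= j)%N /\ (i < A)%N = (j < A)%N).
- move=> i; rewrite /phi; do ![case: ifP => _] => //.
  + by move=> t; apply: continuousN; exact: G_cont.
  + by move=> t; apply: (@continuousN _ _ _ (fun t => G (- t))); exact: GN_cont.
- move=> i; rewrite /sgn /d.
  case: (letterP i) => -[il [E1 E2 E3 E4]]; rewrite ?E1 ?E2 ?E3.
  + by have /andP[ec1 _] := cover_GL cover il; rewrite x_le.
  + have /andP[/andP[_ es] _] := cover_BL cover il.
    by rewrite (le_trans _ (ltW sw)) ?x_le.
  + by have /andP[c2e _] := cover_GR cover il; rewrite lerN2 x_le.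
  + have /andP[/andP[s'e _] _] := cover_BR cover il.
    by rewrite lerN2 (le_trans (ltW ws')) ?x_le.
- move=> i; rewrite /sgn /phi.
  case: (letterP i) => -[il [E1 E2 E3 E4]]; rewrite ?E1 ?E2 ?E3 E4 ?opprK Gx.
  + by have /andP[_ pe] := cover_GL cover il; rewrite x_le.
  + by have /andP[_ pe] := cover_BL cover il; rewrite lerN2 x_le.
  + by have /andP[_ pe] := cover_GR cover il; rewrite lerN2 x_le.
  + by have /andP[_ pe] := cover_BR cover il; rewrite x_le.
- move=> i; apply: le_trans (dw _) _; rewrite /sgn /phi /d.
  have /andP[s'pc1 pc2s] := cover_turn cover.
  case: (letterP i) => -[il [E1 E2 E3 E4]]; rewrite ?E1 ?E2 ?E3 E4 ?opprK ?Gw //.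
  + by rewrite Gx (le_trans (ltW ws')) ?x_le.
  + by rewrite Gx lerN2 (le_trans _ (ltW sw)) ?x_le.
- move=> i j [ij sideij].
  (* On one side, two indices of the same kind share their map, and [rot] preserves their order.
     Otherwise [i] stays and [j] changes sides, and [c1] or [c2] separates their intervals. *)
  have [same|diff] := boolP (((i + b < A)%N == (j + b < A)%N) && ((i + b < q)%N == (j + b < q)%N)).
    have /andP[/eqP same1 /eqP same2] := same.
    right; split.
    + by rewrite /phi same1 sideij same2.
    + rewrite /sgn sideij; case: ifP => jA; rewrite ?lerN2 x_le.
        by apply: (cover_monoL cover); rewrite ij.
      by apply: (cover_monoR cover); rewrite ij andbT; lia.
    + by rewrite /d same1 sideij same2.
    + have iq := ltn_ord i; have jq := ltn_ord j.
      by rewrite !rotE same2; case: ifP; lia.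
  left; rewrite /d /sgn; case: (ltnP j A) => jA.
    rewrite ifT; last by lia.
    rewrite x_le; have /andP[/andP[]//] : (c1 <= e j <= s)%N && (e (rot j) <= p (e j))%N.
    by apply: (cover_BL cover); lia.
  have -> : (i + b < A)%N = false by lia.
  have -> : (i < A)%N = false by lia.
  have -> : (i + b < q)%N = true by lia.
  rewrite lerN2 x_le; have /andP[/andP[]//] : (s' <= e j <= c2)%N && (p (e j) <= e (rot j))%N.
  by apply: (cover_BR cover); lia.
move=> Y [Yed phiY Ymono]; exists (fun i => sgn i (Y i)).
have YL (i : 'I_q) : (i < A)%N -> x (e i) <= Y i <= w.
  move=> iA; have := Yed i; have := dw i; rewrite /sgn iA => dwi /andP[-> Yd].
  exact: le_trans Yd dwi.
have YR (i : 'I_q) : (A <= i)%N -> w <= - Y i <= x (e i).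
  move=> iA; have := Yed i; have := dw i; rewrite /sgn; rewrite leqNgt in iA.
  rewrite (negPf iA); by move=> dwi /andP[xY Yd]; rewrite lerNr (le_trans Yd dwi) lerNl.
split.
- move=> i; have := phiY i; rewrite /phi /sgn.
  case: (letterP i) => -[il [E1 E2 E3 E4]]; rewrite ?E1 ?E2 ?E3 E4 //.
  + by move=> <-; rewrite opprK.
  + by move=> <-; rewrite opprK.
- have [wlo whi] : lo <= w /\ w <= hi.
    have := x_in s; have := x_in s'; rewrite !in_itv /= => /andP[_ shi] /andP[slo _].
    by rewrite (le_trans slo (ltW sw)) (le_trans (ltW ws') shi).
  move=> i; rewrite /sgn; have := x_in (e i); rewrite !in_itv /=.
  case: ltnP => iA /andP[elo ehi].
    by have /andP[eY Yw] := YL i iA; rewrite (le_trans elo eY) (le_trans Yw whi).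
  by have /andP[eY Yw] := YR i iA; rewrite (le_trans wlo eY) (le_trans Yw ehi).
- move=> i; rewrite /sgn; case: ltnP => iA; first by case/andP: (YL i iA).
  by case/andP: (YR i iA).
- split=> i il; rewrite /sgn; have := Yed i; rewrite /d.
    rewrite il ifT; last by lia.
    by move=> /andP[_ Yc1]; apply: le_lt_trans Yc1 xc1w.
  have -> : (i + b < A)%N = false by lia.
  have -> : (i < A)%N = false by lia.
  have -> : (i + b < q)%N = true by lia.
  by move=> /andP[_]; rewrite lerNr; apply: lt_le_trans.
- move=> i j ij sideij; have := Ymono i j (conj ij sideij).
  by rewrite /sgn -sideij; case: (i < A)%N => //; rewrite lerN2.
Qed.

(** The loop obtained so far is only weakly ordered. It avoids the fixed point: if one of its points
    were [w], all would be, although those of the indices that stay on their side differ from [w].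
    Its order is then shown to be strict, and undoing the flip lists its points from left to
    right. *)
Lemma cover_orbit : exists2 Q : {fset R}, periodic_orbit lo hi g Q &
  exhibits g Q (rotation_pattern b_gt0 cobq leAq).
Proof.
have [w [sw ws' Gw]] := fixed_point.
have [z [Gz z_in z_side [zL zR] z_mono]] := loop_exists sw ws' Gw.
have Gzk i k : iter k G (z i) = z (iter k rot i).
  by elim: k => //= k ->; rewrite Gz.
have z_neq i : z i != w.
  apply/eqP => ziw.
  have zw j : z j = w.
    have [k <-] := circle_rot_transitive i j b_gt0 cobq.
    by rewrite -Gzk ziw; elim: k => //= k ->.
  have q_gt0 : (0 < q)%N by lia.
  case: (ltnP b A) => bA; first by have := zL (Ordinal q_gt0) bA; rewrite zw ltxx.
  have Aq : (A < q)%N by lia.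
  have /zR : (A <= Ordinal Aq)%N && (Ordinal Aq + b < q)%N by rewrite /=; lia.
  by rewrite zw ltxx.
(* An equality of neighbours is carried by the rotation to the positions [A - 1] and [A]. They lie
   on opposite sides of [w], so both points would be [w]. *)
have z_succ (i j : 'I_q) : j = i.+1 :> nat -> z i != z j.
  move=> ji; apply/eqP => zij.
  have Aq : (A.-1 < q)%N by lia.
  have Aq' : (A < q)%N by lia.
  have [k ki] := circle_rot_transitive i (Ordinal Aq) b_gt0 cobq.
  have kj : iter k rot j = Ordinal Aq'.
    apply/ord_inj; move/(congr1 val): ki; rewrite /= !iter_circle_rot ji => ki.
    by rewrite addSn -addn1 -modnDml ki modn_small; lia.
  have := Gzk i k; rewrite zij Gzk ki kj => zA.
  have := z_side (Ordinal Aq); have := z_side (Ordinal Aq').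
  rewrite /= ltnn ifT; last by lia.
  rewrite zA => w1 w2; have /negP := z_neq (Ordinal Aq); apply.
  by rewrite eq_le w1 w2.
have z_strict (i j : 'I_q) : (i < j)%N -> (i < A)%N = (j < A)%N ->
    if (i < A)%N then z i < z j else z j < z i.
  move=> ij side.
  have iq : (i.+1 < q)%N by have := ltn_ord j; lia.
  have side' : (i < A)%N = (Ordinal iq < A)%N by rewrite /=; lia.
  have side'' : (Ordinal iq < A)%N = (j < A)%N by rewrite -side'.
  have := z_succ i (Ordinal iq) erefl.
  have := z_mono i (Ordinal iq) (leqnSn i) side'.
  have := z_mono (Ordinal iq) j ij side''.
  rewrite -side'; case: ifP => iA h1 h2 h3.
    by apply: lt_le_trans h1; rewrite lt_neqAle h3.
  by apply: le_lt_trans h1 _; rewrite lt_neqAle eq_sym h3.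
have [||| Q []] := @exhibits_orbit R lo hi g
    (rotation_pattern b_gt0 cobq leAq) (fun k => z (circle_flip A k)).
- suff z_incr (i j : 'I_q) : (i < j)%N ->
    z (circle_flip A i) < z (circle_flip A j) by exact: z_incr.
  move=> ij; have iq := ltn_ord i; have jq := ltn_ord j.
  have := circle_flip_lt A i; have := circle_flip_lt A j.
  have := z_strict (circle_flip A i) (circle_flip A j).
  have := z_strict (circle_flip A j) (circle_flip A i).
  have := z_side (circle_flip A i); have := z_side (circle_flip A j).
  have := z_neq (circle_flip A i); have := z_neq (circle_flip A j).
  have fE (k : 'I_q) : circle_flip A k =
      (if (k < A)%N then k : nat else q.-1 + A - k)%N :> nat by [].
  move: (z (circle_flip A i)) (z (circle_flip A j)) => zi zj.
  move=> nj ni sj si st1 st2 fj fi; rewrite fj fi in sj si st1 st2.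
  case: (ltnP i A) => iA; case: (ltnP j A) => jA.
  + by rewrite iA jA !fE iA jA in st2; exact: st2.
  + rewrite iA in si; rewrite ltnNge jA /= in sj.
    by apply: (@lt_le_trans _ _ w) => //; rewrite lt_neqAle ni.
  + by have := leq_ltn_trans iA ij; rewrite ltnNge (ltnW jA).
  + have nA (k : 'I_q) : (A <= k)%N -> (k < A)%N = false by lia.
    by rewrite !nA ?fE ?nA // in st1; apply: st1 => //; lia.
- by move=> i; exact: z_in.
- move=> i; rewrite /= -Gg ?z_in // Gz permE /rotation_fun.
  by rewrite circle_flipK.
by exists Q.
Qed.

End CoverForces.

Lemma cover_forces (R : realType) (p : pattern) (q b A : nat)
    (b_gt0 : (0 < b)%N) (cobq : coprime b q) (leAq : (b <= A <= q - b)%N)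
    (e : 'I_q -> 'I_(period p)) (c1 s s' c2 : 'I_(period p)) :
  (2 * b < q)%N -> rotation_cover p b A e c1 s s' c2 ->
  forces R p (rotation_pattern b_gt0 cobq leAq).
Proof.
move=> lt2b cover lo hi g [lohi g_cont _] [P [_ P_sub _ _] P_exhibits].
have [G G_cont Gg] := continuous_extension (ltW lohi) g_cont.
exact: (cover_orbit b_gt0 cobq leAq lt2b cover P_sub P_exhibits G_cont Gg).
Qed.

(** * Phases *)

(** Partial sums of [w] along the orbit of the first index are a primitive; the vanishing total
    makes it consistent when the orbit closes up. The phases are obtained in this way. *)
Lemma cyclic_primitive (p : pattern) (w : 'I_(period p) -> int) :
  \sum_i w i = 0 -> exists k : 'I_(period p) -> int, forall i, k (p i) = k i + w i.
Proof.
move=> w0; pose x0 := Ordinal (period_gt0 p).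
have p_inj : injective p by exact: perm_inj.
have conn i : fconnect p x0 i.
  by have [k <-] := pattern_transitive x0 i; exact: fconnect_iter.
pose k i := \sum_(t < findex p x0 i) w (iter t p x0); exists k => i.
have sum_orbit : \sum_(t < fingraph.order p x0) w (iter t p x0) = 0.
  rewrite -[RHS]w0 -(big_mkord xpredT (fun t => w (iter t p x0))) /index_iota subn0.
  rewrite -(big_map (fun t => iter t p x0) xpredT w).
  have -> : [seq iter t p x0 | t <- iota 0 (fingraph.order p x0)] = fingraph.orbit p x0.
    rewrite /fingraph.orbit; elim: (fingraph.order p x0) => // m IHm.
    by rewrite trajectSr -IHm -addn1 iotaD map_cat /= add0n cats1.
  apply: perm_big; apply: uniq_perm; rewrite ?fingraph.orbit_uniq ?index_enum_uniq // => j.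
  by rewrite -fconnect_orbit conn mem_index_enum.
have kE t : (t < fingraph.order p x0)%N -> k (iter t p x0) = \sum_(t' < t) w (iter t' p x0).
  by move=> t_lt; rewrite /k findex_iter.
have := findex_max (conn i); set t := findex p x0 i => t_lt.
have iE : iter t p x0 = i by exact: iter_findex.
rewrite -iE kE // -iterS.
have [St_lt|] := ltnP t.+1 (fingraph.order p x0); first by rewrite kE // big_ord_recr.
move=> le_t; have St : t.+1 = fingraph.order p x0 by apply/eqP; rewrite eqn_leq t_lt le_t.
have kx0 : k x0 = 0 by rewrite (kE 0%N) ?fingraph.order_gt0 // big_ord0.
by rewrite St fingraph.iter_order // kx0 -[LHS]sum_orbit -St big_ord_recr.
Qed.

Lemma exists_minimizer (I : finType) (P : pred I) (F : I -> int) (i0 : I) :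
  P i0 -> exists2 m, P m & forall i, P i -> F m <= F i.
Proof. by move=> Pi0; case: (Order.TotalTheory.arg_minP F Pi0) => m; exists m. Qed.

(** What the phase argument uses of the laps: the direction of motion changes only once, just after
    [s], and every point between the preimages [c1] and [c2] of the two extreme points crosses
    over. *)
Record convergent_shape (n : nat) (p : 'S_n) (s c1 c2 : 'I_n) : Prop := ConvergentShape {
  shape_up : forall i : 'I_n, (i <= s)%N -> (i < p i)%N;
  shape_down : forall i : 'I_n, (s < i)%N -> (p i < i)%N;
  shape_order : (c1 <= s < c2)%N;
  shape_max : p c1 = n.-1 :> nat;
  shape_min : p c2 = 0%N :> nat;
  shape_left : forall i : 'I_n, (c1 <= i <= s)%N -> (s < p i)%N;
  shape_right : forall i : 'I_n, (s < i <= c2)%N -> (p i <= s)%N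
}.

Section CountSwitches.
Local Open Scope set_scope.

(** A permutation preserves cardinality, so a set and its preimage have equally many elements
    outside their intersection. *)
Lemma card_switch (n : nat) (p : 'S_n) (S : {set 'I_n}) :
  #|[set i in S | p i \notin S]| = #|[set i | (i \notin S) && (p i \in S)]|.
Proof.
have pS : #|p @^-1: S| = #|S|.
  rewrite -[RHS](card_imset _ (@perm_inj _ p^-1%g)); apply: eq_card => i.
  rewrite inE; apply/idP/imsetP => [pi|[j jS ->]]; last by rewrite permKV.
  by exists (p i); rewrite ?permK.
have -> : [set i in S | p i \notin S] = S :\: p @^-1: S.
  by apply/setP => i; rewrite !inE andbC.
have -> : [set i | (i \notin S) && (p i \in S)] = (p @^-1: S) :\: S.
  by apply/setP => i; rewrite !inE.
by apply/eqP; rewrite -(eqn_add2l #|S :&: p @^-1: S|) cardsID finset.setIC cardsID pS.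
Qed.

(** Here a change of direction is a change of side, and half of these changes go from right to left.
    The resulting equation says that the phase increments sum to zero over the cycle. *)
Lemma shape_over_rotation (p : pattern) (s c1 c2 : 'I_(period p)) (b q : nat) :
  (0 < q)%N -> convergent_shape p s c1 c2 ->
  pattern_over_rotation p = b%:R / q%:R ->
  (period p * b)%N = (q * #|[set i : 'I_(period p) | (s < i)%N && (p i <= s)%N]%SET|)%N.
Proof.
move=> q_gt0 shp; rewrite /pattern_over_rotation.
have up (i : 'I_(period p)) : (i < p i)%N = (i <= s)%N.
  have [/(shape_up shp)//|/(shape_down shp)] := leqP i s.
  by move=> /ltnW; rewrite leqNgt => /negPf.
pose S := [set i : 'I_(period p) | (i <= s)%N].
pose D := [set i : 'I_(period p) | (s < i)%N && (p i <= s)%N].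
have -> : [set i : 'I_(period p) | (i < p i)%N != (p i < p (p i))%N] =
    [set i in S | p i \notin S] :|: [set i | (i \notin S) && (p i \in S)].
  by apply/setP => i; rewrite !inE !up; case: (i <= s)%N; case: (p i <= s)%N.
rewrite cardsU card_switch.
have -> : [set i in S | p i \notin S] :&: [set i | (i \notin S) && (p i \in S)] = finset.set0.
  by apply/setP => i; rewrite !inE; case: (i <= s)%N; case: (p i <= s)%N.
have -> : [set i | (i \notin S) && (p i \in S)] = D.
  by apply/setP => i; rewrite !inE ltnNge.
rewrite cards0 subn0 addnn -mul2n !natrM -mulf_div divff ?mul1r // => /eqP.
rewrite eqr_div ?pnatr_eq0 -?lt0n ?period_gt0 // -!natrM eqr_nat => /eqP.
by rewrite mulnC => ->; rewrite mulnC.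
Qed.

End CountSwitches.

(* The phase k increases by b at each step and drops by q at each return from
   the right to the left.  With mL, mR of minimal phase on each side, e i is the
   point of phase at most k mL + i which lies furthest along the circle: its
   image has phase at most k mL + i + b, hence does not lie beyond e (i + b). *)
Lemma shape_cover (p : pattern) (s c1 c2 : 'I_(period p)) (b q : nat) :
  (0 < b)%N -> (2 * b < q)%N -> convergent_shape p s c1 c2 ->
  pattern_over_rotation p = b%:R / q%:R ->
  exists A (e : 'I_q -> 'I_(period p)) (s' : 'I_(period p)),
    (b <= A <= q - b)%N /\ rotation_cover p b A e c1 s s' c2.
Proof.
move=> b_gt0 lt2b shp rho.
have [[/andP[c1s sc2] pc1] pc2] := (shape_order shp, shape_max shp, shape_min shp).
have [black_L black_R] := (shape_left shp, shape_right shp).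
have q_gt0 : (0 < q)%N by lia.
have card_BR := shape_over_rotation q_gt0 shp rho.
pose BR (i : 'I_(period p)) := (s < i)%N && (p i <= s)%N.
have [|k kp] := @cyclic_primitive p (fun i => b%:Z - (if BR i then q%:Z else 0)).
  rewrite big_split /= sumr_const card_ord sumrN -big_mkcond /= sumr_const.
  apply/eqP; rewrite subr_eq0 -(mulr_natr b%:Z) -(mulr_natr q%:Z) !natz.
  by rewrite -!PoszM eqz_nat mulnC card_BR cardsE.
have [mL mLs k_mL] := @exists_minimizer _ (fun v : 'I_(period p) => v <= s)%N k s (leqnn s).
have [mR mRs k_mR] := @exists_minimizer _ (fun v : 'I_(period p) => s < v)%N k c2 sc2.
have kp' i : k (p i) = k i + b%:Z - (if BR i then q%:Z else 0) by rewrite kp addrA.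
(* A point of minimal phase on its side has its preimage on the other side, since each step within a
   side adds [b > 0]. Comparing the phases of the two points gives [b <= A <= q - b]. *)
have leLR : k mL + b%:Z <= k mR.
  have := kp' ((p : {perm _})^-1 mR)%g; rewrite permKV /BR permKV [(mR <= s)%N]leqNgt mRs /= andbF.
  have [/k_mL|/k_mR] := leqP ((p : {perm _})^-1 mR)%g s; lia.
have leRL : k mR + b%:Z <= k mL + q%:Z.
  have := kp' ((p : {perm _})^-1 mL)%g; rewrite permKV /BR permKV mLs andbT.
  have [/k_mL|/k_mR] := leqP ((p : {perm _})^-1 mL)%g s; lia.
pose A := absz (k mR - k mL).
have AE : A%:Z = k mR - k mL by rewrite /A; lia.
have e_ex (i : 'I_q) : exists v : 'I_(period p), if (i < A)%N then
    [/\ (v <= s)%N, k v <= k mL + i%:Z &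
      forall u : 'I_(period p), (u <= s)%N -> k u <= k mL + i%:Z -> (u <= v)%N]
    else [/\ (s < v)%N, k v <= k mL + i%:Z &
      forall u : 'I_(period p), (s < u)%N -> k u <= k mL + i%:Z -> (v <= u)%N].
  case: ltnP => iA.
    have [|m /andP[ms km] mmax] := @exists_minimizer _
      (fun v : 'I_(period p) => (v <= s)%N && (k v <= k mL + i%:Z)) (fun v => - v%:Z) mL.
      by rewrite mLs; lia.
    by exists m; split=> // u us ku; have := mmax u; rewrite us ku => /(_ isT); lia.
  have [|m /andP[ms km] mmin] := @exists_minimizer _
    (fun v : 'I_(period p) => (s < v)%N && (k v <= k mL + i%:Z)) (fun v => v%:Z) mR.
    by rewrite mRs; lia.
  by exists m; split=> // u us ku; have := mmin u; rewrite us ku => /(_ isT); lia.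
have /fin_all_exists[E EP] := e_ex.
(* For an index that changes sides, the furthest point may stop short of [c1] or [c2] and fail to
   cross over. It is then replaced by [c1] or [c2], whose image is extreme and covers whatever is
   required. *)
pose e (i : 'I_q) := if (i < A)%N then
    if (i + b < A)%N || (c1 <= E i)%N then E i else c1
  else if (i + b < q)%N || (E i <= c2)%N then E i else c2.
have sn : (s.+1 < period p)%N by have := ltn_ord c2; lia.
exists A, e, (Ordinal sn); split; first lia.
have rotE (i : 'I_q) := @val_circle_rot q b i.
have bq : (b <= q)%N by lia.
have EL (i : 'I_q) : (i < A)%N -> [/\ (E i <= s)%N, k (E i) <= k mL + i%:Z &
      forall u : 'I_(period p), (u <= s)%N -> k u <= k mL + i%:Z -> (u <= E i)%N].
  by move=> iA; have := EP i; rewrite iA.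
have ER (i : 'I_q) : (A <= i)%N -> [/\ (s < E i)%N, k (E i) <= k mL + i%:Z &
      forall u : 'I_(period p), (s < u)%N -> k u <= k mL + i%:Z -> (E i <= u)%N].
  by move=> iA; have := EP i; rewrite ltnNge iA.
have eL (i : 'I_q) : (i < A)%N -> (E i <= e i)%N by rewrite /e => ->; case: ifP; lia.
have eR (i : 'I_q) : (A <= i)%N -> (e i <= E i)%N.
  by rewrite /e leqNgt => /negPf ->; case: ifP; lia.
have le_max (i : 'I_(period p)) : (i <= p c1)%N by rewrite pc1; have := ltn_ord i; lia.
split.
- by rewrite c1s /= leqnn sc2.
- rewrite /= black_L ?c1s ?leqnn //= black_R //=; lia.
- by rewrite /= pc1 pc2; lia.
- move=> i iA; have iA' : (i < A)%N by lia.
  have rE : circle_rot b i = (i + b)%N :> nat by rewrite rotE //; case: ifP; lia.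
  have [Es kE _] := EL i iA'.
  have [rs kr rmax] := EL (circle_rot b i) ltac:(lia).
  have ei : e i = E i by rewrite /e iA' iA.
  have notBR : BR (E i) = false by rewrite /BR ltnNge Es.
  (* Crossing would give a point on the right of phase at most [k mL + i + b], which is less than
     [k mL + A = k mR], the minimum there. *)
  have pEs : (p (E i) <= s)%N.
    rewrite leqNgt; apply/negP => /k_mR; rewrite kp' notBR; lia.
  rewrite ei; apply/andP; split.
    have [//|/ltnW c1E] := leqP (E i) c1.
    by have := black_L (E i); rewrite c1E Es => /(_ isT); lia.
  apply: leq_trans (rmax _ pEs _) (eL _ _); last by lia.
  by rewrite kp' notBR; lia.
- move=> i /andP[iA iA'].
  have rE : circle_rot b i = (i + b)%N :> nat by rewrite rotE //; case: ifP; lia.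
  have [Es kE _] := EL i iA.
  have [rs kr rmin] := ER (circle_rot b i) ltac:(lia).
  have ei : e i = if (c1 <= E i)%N then E i else c1.
    by rewrite /e iA; have -> : (i + b < A)%N = false by lia.
  rewrite ei; case: ifP => c1E; last by rewrite leqnn c1s le_max.
  rewrite Es c1E /=; have notBR : BR (E i) = false by rewrite /BR ltnNge Es.
  have sp : (s < p (E i))%N by apply: black_L; rewrite c1E.
  apply: leq_trans (eR _ _) (rmin _ sp _); first lia.
  by rewrite kp' notBR; lia.
- move=> i /andP[iA iq].
  have rE : circle_rot b i = (i + b)%N :> nat by rewrite rotE //; case: ifP; lia.
  have [Es kE _] := ER i iA.
  have [rs kr rmin] := ER (circle_rot b i) ltac:(lia).
  have ei : e i = E i by rewrite /e iq; have -> : (i < A)%N = false by lia.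
  have sp : (s < p (E i))%N.
    rewrite ltnNge; apply/negP => ps; have := k_mL _ ps.
    by rewrite kp' /BR Es ps /=; lia.
  have notBR : BR (E i) = false by rewrite /BR [(p _ <= s)%N]leqNgt sp andbF.
  rewrite ei; apply/andP; split.
    have [//|/ltnW Ec2] := leqP c2 (E i).
    by have := black_R (E i); rewrite Ec2 Es => /(_ isT); lia.
  apply: leq_trans (eR _ _) (rmin _ sp _); first lia.
  by rewrite kp' notBR; lia.
- move=> i iq; have iA : (A <= i)%N by lia.
  have iq' := ltn_ord i.
  have rE : circle_rot b i = (i + b - q)%N :> nat by rewrite rotE //; case: ifP; lia.
  have [Es kE _] := ER i iA.
  have [rs kr rmax] := EL (circle_rot b i) ltac:(lia).
  have ei : e i = if (E i <= c2)%N then E i else c2.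
    rewrite /e; have -> : (i < A)%N = false by lia.
    by have -> : (i + b < q)%N = false by lia.
  rewrite ei; case: ifP => Ec2; last by rewrite leqnn sc2 pc2.
  rewrite Es Ec2 /=; have ps : (p (E i) <= s)%N by apply: black_R; rewrite Es.
  apply: leq_trans (rmax _ ps _) (eL _ _); last by lia.
  by rewrite kp' /BR Es ps rE /=; lia.
- move=> i j /andP[ij jA]; have iA : (i < A)%N by lia.
  have [Eis kEi _] := EL i iA; have [_ _ Ejmax] := EL j jA.
  have Eij : (E i <= E j)%N by apply: Ejmax => //; lia.
  rewrite /e iA jA; do ![case: ifP => ?]; lia.
- move=> i j /andP[iA ij]; have jA : (A <= j)%N by lia.
  have [Eis kEi _] := ER i iA; have [_ _ Ejmin] := ER j jA.
  have Eij : (E j <= E i)%N by apply: Ejmin => //; lia.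
  rewrite /e; have -> : (i < A)%N = false by lia.
  have -> : (j < A)%N = false by lia.
  do ![case: ifP => ?]; lia.
Qed.

(** * Laps and shapes *)

(** With [A = b] every index on the left changes sides, and three endpoints suffice. All of them lie
    between [c1] and [r], while [c1] and [r] are sent to [r] or beyond and [c2] to [c1] or below. *)
Lemma horseshoe_cover (n : nat) (p : 'S_n) (q b : nat) (c1 c2 r : 'I_n) :
  (2 * b < q)%N -> (c1 < c2 < r)%N -> (r <= p c1)%N -> (p c2 <= c1)%N ->
  (r <= p r)%N -> exists e : 'I_q -> 'I_n, rotation_cover p b b e c1 c1 c2 c2.
Proof.
move=> lt2b /andP[c12 c2r] rp pc2 rpr.
exists (fun i => if (i < b)%N then c1 else if (i + b < q)%N then r else c2).
have e_bounds (i : 'I_q) :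
    (c1 <= (if (i < b)%N then c1 else if (i + b < q)%N then r else c2) <= r)%N.
  by do ![case: ifP => _]; lia.
split=> [| | |i|i|i|i|i j|i j].
- by rewrite !leqnn c12.
- by rewrite pc2 (leq_trans (ltnW c2r)).
- by rewrite pc2 (leq_trans (ltnW c2r)).
- lia.
- by move=> /andP[-> _]; have := e_bounds (circle_rot b i); lia.
- move=> /andP[ib iq]; have -> : (i < b)%N = false by lia.
  by rewrite iq; have := e_bounds (circle_rot b i); lia.
- move=> iq; have -> : (i < b)%N = false by lia.
  have -> : (i + b < q)%N = false by lia.
  by have := e_bounds (circle_rot b i); lia.
- by do ![case: ifP => ?]; lia.
- by do ![case: ifP => ?]; lia.
Qed.

Lemma mirror_horseshoe_cover (n : nat) (p : 'S_n) (q b : nat) (l c1 c2 : 'I_n) :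
  (2 * b < q)%N -> (l < c1 < c2)%N -> (p l <= l)%N -> (c2 <= p c1)%N ->
  (p c2 <= l)%N -> exists e : 'I_q -> 'I_n, rotation_cover p b (q - b) e c1 c1 c2 c2.
Proof.
move=> lt2b /andP[lc1 c12] pll c2p pc2.
exists (fun i => if (i + b < q - b)%N then l else if (i < q - b)%N then c1 else c2).
have e_bounds (i : 'I_q) :
    (l <= (if (i + b < q - b)%N then l else if (i < q - b)%N then c1 else c2) <= c2)%N.
  by do ![case: ifP => _]; lia.
split=> [| | |i|i|i|i|i j|i j].
- by rewrite !leqnn c12.
- by rewrite c2p (leq_trans pc2 (ltnW lc1)).
- by rewrite c2p (leq_trans pc2 (ltnW lc1)).
- by move=> ->; have := e_bounds (circle_rot b i); lia.
- move=> /andP[iA iA']; have -> : (i + b < q - b)%N = false by lia.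
  by rewrite iA; have := e_bounds (circle_rot b i); lia.
- lia.
- move=> iq; have -> : (i + b < q - b)%N = false by lia.
  have -> : (i < q - b)%N = false by lia.
  by have := e_bounds (circle_rot b i); lia.
- by do ![case: ifP => ?]; lia.
- by do ![case: ifP => ?]; lia.
Qed.

(* The three laps of p, where the middle lap consists of the indices outside
   L1 and L3; up says whether p increases on the outer laps. *)
Record three_laps (n : nat) (p : 'S_n) (up : bool) (L1 L3 : pred 'I_n) : Prop := ThreeLaps {
  lap1_closed : forall i j : 'I_n, (i <= j)%N -> L1 j -> L1 i;
  lap3_closed : forall i j : 'I_n, (i <= j)%N -> L3 i -> L3 j;
  lap1_mono : forall i j : 'I_n, L1 i -> L1 j -> (i <= j)%N ->
    if up then (p i <= p j)%N else (p j <= p i)%N;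
  lap2_mono : forall i j : 'I_n, ~~ L1 i -> ~~ L3 j -> (i <= j)%N ->
    if up then (p j <= p i)%N else (p i <= p j)%N;
  lap3_mono : forall i j : 'I_n, L3 i -> L3 j -> (i <= j)%N ->
    if up then (p i <= p j)%N else (p j <= p i)%N
}.

Section Shapes.
Variable p : pattern.
Local Notation n := (period p).
Hypothesis p_gt1 : (1 < n)%N.

Let o0 : 'I_n := Ordinal (period_gt0 p).

Let last_subproof : (n.-1 < n)%N. Proof. by rewrite ltn_predL period_gt0. Qed.
Let om : 'I_n := Ordinal last_subproof.

Let le_om (i : 'I_n) : (i <= om)%N.
Proof. by have := ltn_ord i; rewrite /=; lia. Qed.

Let p_moves (i : 'I_n) : (i < p i)%N = ~~ (p i < i)%N.
Proof.
have := pattern_not_fixed i p_gt1; rewrite -(inj_eq val_inj) /=.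
by case: ltngtP.
Qed.

Lemma no_invariant_segment (m : nat) : (0 < m < n)%N ->
  (forall k : 'I_n, (k < m)%N -> (p k < m)%N) -> False.
Proof.
move=> /andP[m0 mn] pm.
have := @pattern_closed p (fun k => k < m)%N o0 om pm m0; rewrite /=; lia.
Qed.

Lemma no_invariant_upper_segment (m : nat) : (0 < m < n)%N ->
  (forall k : 'I_n, (m <= k)%N -> (m <= p k)%N) -> False.
Proof.
move=> /andP[m0 mn] pm.
have mom : (m <= om)%N by rewrite /=; lia.
have := @pattern_closed p (fun k => m <= k)%N om o0 pm mom; rewrite /=; lia.
Qed.

Let no_end_swap : (2 < n)%N -> p o0 = om -> p om = o0 -> False.
Proof.
move=> n_gt2 p0 pm.
have := @pattern_closed p (fun k => (k == o0) || (k == om)) o0 (Ordinal (ltnW n_gt2)).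
case/(_ _ _)/orP => [k /orP[] /eqP ->||/eqP/(congr1 val)|/eqP/(congr1 val)] //=.
- by rewrite p0 eqxx orbT.
- by rewrite pm eqxx.
- lia.
Qed.

Let c1 : 'I_n := ((p : {perm _})^-1 om)%g.
Let c2 : 'I_n := ((p : {perm _})^-1 o0)%g.
Let pc1 : p c1 = om. Proof. exact: permKV. Qed.
Let pc2 : p c2 = o0. Proof. exact: permKV. Qed.

Let c1P i : (om <= p i)%N -> i = c1.
Proof.
move=> pi; apply: (@perm_inj _ p); rewrite pc1; apply/val_inj => /=.
by have := le_om (p i); rewrite /= in pi *; lia.
Qed.

Let c2P i : (p i <= o0)%N -> i = c2.
Proof.
move=> pi; apply: (@perm_inj _ p); rewrite pc2; apply/val_inj => /=.
by rewrite /= in pi *; lia.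
Qed.

(** Take for [s] the last point moving right: the hypothesis allows no point moving left before it.
    The preimage of the maximum moves right and that of the minimum moves left. *)
Let split_point :
  (forall i j : 'I_n, (i < j)%N -> (p i < i)%N -> (p j < j)%N) ->
  exists s : 'I_n, [/\ forall i : 'I_n, (i <= s)%N -> (i < p i)%N,
    forall i : 'I_n, (s < i)%N -> (p i < i)%N & (c1 <= s < c2)%N].
Proof.
move=> conv.
have o0up : (o0 < p o0)%N by rewrite p_moves.
have [s sup s_max] := @exists_minimizer _ (fun i : 'I_n => i < p i)%N
  (fun i => - i%:Z) o0 o0up.
have up (i : 'I_n) : (i <= s)%N -> (i < p i)%N.
  rewrite leq_eqVlt => /orP[/eqP/val_inj -> //|is_].
  rewrite p_moves; apply/negP => /(conv _ _ is_); rewrite p_moves in sup.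
  exact/negP.
have down (i : 'I_n) : (s < i)%N -> (p i < i)%N.
  move=> si; apply: contraT; rewrite -p_moves => /s_max; lia.
exists s; split => //; apply/andP; split.
  rewrite leqNgt; apply/negP => /down; rewrite pc1.
  by have := le_om c1; lia.
by rewrite ltnNge; apply/negP => /up; rewrite pc2.
Qed.

Let c1_max (i : 'I_n) : (p i <= p c1)%N. Proof. by rewrite pc1. Qed.

(** On the first lap every point moves right, since a point moving left would bound an invariant
    initial segment; symmetrically, every point of the third lap moves left. So the direction
    changes within the decreasing lap, or at its ends, and monotonicity there makes the points
    between [c1] and [c2] cross over. *)
Lemma up_down_up_shape (L1 L3 : pred 'I_n) : three_laps p true L1 L3 ->
  exists s d1 d2, convergent_shape p s d1 d2.
Proof.
move=> [L1c L3c m1 m2 m3]; rewrite /= in m1 m2 m3.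
have up1 (i : 'I_n) : L1 i -> (i < p i)%N.
  move=> Li; rewrite p_moves; apply/negP => pi.
  apply: (@no_invariant_segment i); first by have := ltn_ord i; lia.
  move=> k ki; have Lk : L1 k := L1c _ _ (ltnW ki) Li.
  exact: leq_ltn_trans (m1 _ _ Lk Li (ltnW ki)) pi.
have down3 (i : 'I_n) : L3 i -> (p i < i)%N.
  move=> Li; apply: contraT; rewrite -p_moves => pi.
  exfalso; apply: (@no_invariant_upper_segment i.+1).
    by have := ltn_ord (p i); lia.
  move=> k ik; have Lk : L3 k := L3c _ _ (ltnW ik) Li.
  exact: leq_trans pi (m3 _ _ Li Lk (ltnW ik)).
have [|s [up down c1sc2]] := split_point.
  move=> i j ij pi.
  have nL1 : ~~ L1 i by apply/negP => /up1; rewrite p_moves pi.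
  have [/down3 //|nL3] := boolP (L3 j).
  by have := m2 _ _ nL1 nL3 (ltnW ij); lia.
have [c1s sc2] := andP c1sc2.
exists s, c1, c2; split; rewrite ?pc1 ?pc2 //.
- move=> i /andP[c1i is_].
  have [-> | i_neq] := eqVneq i c1; first by rewrite pc1; have := le_om c2; lia.
  have nL1 : ~~ L1 i.
    apply/negP => Li; have := m1 _ _ (L1c _ _ c1i Li) Li c1i; rewrite pc1.
    by move=> /c1P /eqP; rewrite (negPf i_neq).
  have nL3 : ~~ L3 s by apply/negP => /down3; have := up s (leqnn s); lia.
  by apply: leq_trans (m2 _ _ nL1 nL3 is_); exact: up.
- move=> i /andP[si ic2].
  have [-> | i_neq] := eqVneq i c2; first by rewrite pc2.
  have nL3 : ~~ L3 i.
    apply/negP => Li; have := m3 _ _ Li (L3c _ _ ic2 Li) ic2; rewrite pc2.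
    by move=> /c2P /eqP; rewrite (negPf i_neq).
  have sn : (s.+1 < n)%N by have := ltn_ord i; lia.
  have nL1 : ~~ L1 (Ordinal sn).
    by apply/negP => /up1; have := down (Ordinal sn) (ltnSn s); rewrite /=; lia.
  apply: leq_trans (m2 _ _ nL1 nL3 si) _.
  by have := down (Ordinal sn) (ltnSn s); rewrite /=; lia.
Qed.

(** The points [s] and [t] next to the change of direction satisfy [p t <= s < p s], so they are not
    both in the increasing middle lap. In the remaining cases a decreasing lap gives the crossing,
    unless [c1] is in the first lap and [c2] in the third; then the two ends would be exchanged,
    which is impossible in a cycle of more than two points. *)
Lemma down_up_down_convergent (L1 L3 : pred 'I_n) :
  (2 < n)%N -> three_laps p false L1 L3 ->
  (forall i j : 'I_n, (i < j)%N -> (p i < i)%N -> (p j < j)%N) ->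
  exists s d1 d2, convergent_shape p s d1 d2.
Proof.
move=> n_gt2 [L1c L3c m1 m2 m3] conv; rewrite /= in m1 m2 m3.
have [s [up down c1sc2]] := split_point conv.
have [c1s sc2] := andP c1sc2.
have sn : (s.+1 < n)%N by have := ltn_ord c2; lia.
pose t := Ordinal sn.
have pt : (p t <= s)%N by have := down t (ltnSn s); rewrite /=; lia.
have sps := up s (leqnn s).
have swap : L1 c1 -> L3 c2 -> False.
  move=> Lc1 Lc2; apply: no_end_swap => //.
    have L0 : L1 o0 by apply: L1c Lc1.
    have /c1P -> // : (om <= p o0)%N by rewrite -pc1; apply: m1.
  have Lm : L3 om by apply: L3c Lc2; exact: le_om.
  by have /c2P -> // : (p om <= o0)%N by rewrite -pc2; apply: m3 => //; exact: le_om.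
have som : (s < om)%N by apply: leq_trans sc2 (le_om _).
exists s, c1, c2; split; rewrite ?pc1 ?pc2 // => i /andP[].
- move=> c1i is_; have [L1s|nL1s] := boolP (L1 s).
    by apply: leq_trans sps (m1 _ _ (L1c _ _ is_ L1s) L1s is_).
  have [L3s|nL3s] := boolP (L3 s).
    have [L3i|nL3i] := boolP (L3 i); first by apply: leq_trans sps (m3 _ _ L3i L3s is_).
    have [L1c1|nL1c1] := boolP (L1 c1).
      by case: swap => //; apply: L3c (ltnW sc2) L3s.
    by apply: leq_trans som _; rewrite -pc1; exact: m2.
  have [L3t|nL3t] := boolP (L3 t).
    have [L1c1|nL1c1] := boolP (L1 c1); first by case: swap => //; apply: L3c L3t.
    apply: leq_trans som _; rewrite -pc1; apply: m2 => //.
    by apply: contra nL3s; apply: L3c.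
  by have := m2 _ _ nL1s nL3t (leqnSn s); lia.
- move=> si ic2; have [L3t|nL3t] := boolP (L3 t).
    by apply: leq_trans (m3 t i L3t (L3c t i si L3t) si) pt.
  have [L1t|nL1t] := boolP (L1 t).
    have [L1i|nL1i] := boolP (L1 i); first by apply: leq_trans (m1 t i L1t L1i si) pt.
    have [L3c2|nL3c2] := boolP (L3 c2).
      by case: swap => //; apply: L1c L1t; apply: leq_trans c1s (leqnSn s).
    by apply: leq_trans (m2 _ _ nL1i nL3c2 ic2) _; rewrite pc2.
  have [L1s|nL1s] := boolP (L1 s).
    have [L3c2|nL3c2] := boolP (L3 c2); first by case: swap => //; apply: L1c L1s.
    have nL1i : ~~ L1 i by apply: contra nL1t; apply: L1c.
    by apply: leq_trans (m2 _ _ nL1i nL3c2 ic2) _; rewrite pc2.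
  by have := m2 _ _ nL1s nL3t (leqnSn s); lia.
Qed.

(** Let [j] be the first point moving right that has a point moving left before it; its predecessor
    [h] then moves left. Points before [j] have images at most [p o0] or [p h], so the absence of an
    invariant segment forces [p o0] to reach [j]; symmetrically [p om] falls below [j]. The position
    of [c2] or [c1] relative to [j] gives a horseshoe, or else the two ends are exchanged. *)
Lemma down_up_down_divergent (L1 L3 : pred 'I_n) (i0 j0 : 'I_n) :
  (2 < n)%N -> three_laps p false L1 L3 ->
  (i0 < j0)%N -> (p i0 < i0)%N -> (j0 < p j0)%N ->
  (exists d1 d2 r : 'I_n,
    [/\ (d1 < d2 < r)%N, (r <= p d1)%N, (p d2 <= d1)%N & (r <= p r)%N]) \/
  (exists l d1 d2 : 'I_n,
    [/\ (l < d1 < d2)%N, (p l <= l)%N, (d2 <= p d1)%N & (p d2 <= l)%N]).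
Proof.
move=> n_gt2 [L1c L3c m1 m2 m3] ij0 pi0 pj0; rewrite /= in m1 m2 m3.
have Pj0 : (j0 < p j0)%N && [exists i : 'I_n, (i < j0)%N && (p i < i)%N].
  by rewrite pj0; apply/existsP; exists i0; rewrite ij0.
have [j /andP[pj /existsP[i /andP[ij pi]]] j_min] := @exists_minimizer _
  (fun j : 'I_n => (j < p j)%N && [exists i : 'I_n, (i < j)%N && (p i < i)%N])
  (fun j => j%:Z) j0 Pj0.
have hn : (j.-1 < n)%N by have := ltn_ord j; lia.
pose h := Ordinal hn.
have hj : h.+1 = j by rewrite /=; lia.
have ph : (p h < h)%N.
  apply: contraT; rewrite -p_moves => hp.
  have ih : (i < h)%N.
    have : i != h by apply/eqP => ih; move: hp; rewrite -ih p_moves pi.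
    by rewrite -(inj_eq val_inj) /=; lia.
  have : (h < p h)%N && [exists i : 'I_n, (i < h)%N && (p i < i)%N].
    by rewrite hp; apply/existsP; exists i; rewrite ih.
  by move/j_min; lia.
have nL1j : ~~ L1 j.
  by apply/negP => Lj; have := m1 h j (L1c h j ltac:(lia) Lj) Lj ltac:(lia); lia.
have nL3h : ~~ L3 h.
  by apply/negP => Lh; have := m3 h j Lh (L3c h j ltac:(lia) Lh) ltac:(lia); lia.
have low (k : 'I_n) : (k < j)%N -> (p k <= p o0)%N || (p k <= p h)%N.
  move=> kj; have [Lk|nLk] := boolP (L1 k).
    by rewrite (m1 o0 k) //; apply: L1c Lk.
  by rewrite (m2 k h) ?orbT //; lia.
have high (k : 'I_n) : (j <= k)%N -> (p om <= p k)%N || (p j <= p k)%N.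
  move=> jk; have [Lk|nLk] := boolP (L3 k).
    by rewrite (m3 k om) ?le_om //; apply: L3c Lk; exact: le_om.
  by rewrite (m2 j k) ?orbT.
have j_in : (0 < j < n)%N by rewrite ltn_ord andbT; lia.
have p0 : (j <= p o0)%N.
  rewrite leqNgt; apply/negP => p0; apply: (no_invariant_segment j_in) => k kj.
  by case/orP: (low k kj); lia.
have pm : (p om < j)%N.
  rewrite ltnNge; apply/negP => pm; apply: (no_invariant_upper_segment j_in) => k jk.
  by case/orP: (high k jk); lia.
have [c2j|jc2] := ltnP c2 j.
  left; exists o0, c2, j; rewrite pc2; split=> //; last exact: ltnW.
  rewrite c2j andbT lt0n; apply/eqP => c20; move: p0.
  have -> : o0 = c2 by apply/val_inj; rewrite /= c20.
  by rewrite pc2 /=; lia.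
have [c1j|jc1] := ltnP c1 j; last first.
  right; exists h, c1, om; split; [|exact: ltnW|by rewrite pc1|by lia].
  apply/andP; split; first by lia.
  have : c1 != om by apply/eqP => c1m; move: pm; rewrite -c1m pc1 ltnNge le_om.
  by rewrite -(inj_eq val_inj); have := le_om c1; rewrite /=; lia.
exfalso; apply: no_end_swap => //.
  case/orP: (low _ c1j); rewrite pc1; first by move/c1P => ->.
  by move=> omh; have := le_om h; lia.
case/orP: (high _ jc2); rewrite pc2; first by move/c2P => ->.
by move=> /= ; lia.
Qed.

End Shapes.

(** * Cycles of period 2 *)

Lemma coprime12 : coprime 1 2. Proof. by []. Qed.
Lemma two_cycle_bounds : (1 <= 1 <= 2 - 1)%N. Proof. by []. Qed.

(** The rotation pattern of over-rotation number 1/2. Since [cover_forces] asks for [2 * b < q],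
    this pattern is treated separately. *)
Definition two_cycle : pattern :=
  rotation_pattern (ltn0Sn 0) coprime12 two_cycle_bounds.

(** Let [v] be the point sent to the leftmost one and [w] the last fixed point before [v]. Some
    point of the cycle before [w] is sent to [v] or beyond, so some [t] before [w] is sent exactly
    to [v], and its second image does not exceed [t]. A point [s] before [t] with second image at
    least [s] then yields a fixed point of the second iterate. *)
Lemma two_cycle_orbit (R : realType) (lo hi : R) (G : R -> R) (p : pattern)
    (P : {fset R}) :
  continuous G -> {in `[lo, hi], forall x, G x \in `[lo, hi]} ->
  (1 < period p)%N -> {subset P <= `[lo, hi]} -> exhibits G P p ->
  exists z, [/\ z \in `[lo, hi], z < G z & G (G z) = z].
Proof.
move=> G_cont G_in p_gt1 P_sub [cardP GP].
pose x (i : 'I_(period p)) : R := (points P)`_i.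
have x_le i j : (x i <= x j) = (i <= j)%N by rewrite nth_points_le ?cardP.
have x_lt i j : (x i < x j) = (i < j)%N by rewrite nth_points_lt ?cardP.
have x_in i : x i \in `[lo, hi].
  by apply: P_sub; rewrite -mem_points mem_nth // size_points cardP.
have Gx i : G (x i) = x (p i) := GP i.
pose o0 : 'I_(period p) := Ordinal (period_gt0 p).
pose iv := ((p : {perm _})^-1 o0)%g.
have piv : p iv = o0 by exact: permKV.
have iv_gt0 : (0 < iv)%N.
  rewrite lt0n; apply/eqP => iv0; have := pattern_not_fixed iv p_gt1.
  by rewrite piv -(inj_eq val_inj) /= iv0.
set v := x iv; have Gv : G v = x o0 by rewrite Gx piv.
have x0v : x o0 < v by rewrite x_lt.
have x0_le i : x o0 <= x i by rewrite x_le.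
have GBid_cont : continuous (fun t => G t - t).
  by move=> t; apply: cvgB; [exact: G_cont|exact: cvg_id].
have idBG_cont : continuous (fun t => t - G t).
  by move=> t; apply: cvgB; [exact: cvg_id|exact: G_cont].
have [|w [/andP[x0w wv] /eqP + w_last]] :=
    continuous_last_point (v := 0) idBG_cont (ltW x0v).
  by rewrite Gv Gx subr_le0 subr_ge0 x0_le ltW.
rewrite subr_eq0 => /eqP wG.
have {wv} wv : w < v.
  by rewrite lt_neqAle wv andbT; apply/eqP => wE; move: x0v; rewrite -Gv -wE -wG ltxx.
have [i [iw vi]] : exists i, x i <= w /\ v <= G (x i).
  apply: contrapT => none; apply: (@no_invariant_segment p p_gt1 iv).
    by rewrite iv_gt0 ltn_ord.
  move=> k kiv; rewrite -x_lt -Gx ltNge; apply/negP => vG.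
  have [kw|wk] := leP (x k) w; first by apply: none; exists k.
  have xkv : x k < v by rewrite x_lt.
  have : x k <= w.
    by apply: w_last; rewrite ?x0_le ?(ltW xkv) // subr_le0 ltW // (lt_le_trans xkv).
  by rewrite leNgt wk.
have [|t] := @IVT _ G (x i) w v iw (continuous_subspaceT G_cont).
  by rewrite ge_min -wG (ltW wv) orbT le_max vi.
rewrite in_itv /= => /andP[it tw] Gt.
have tv : t < v := le_lt_trans tw wv.
have x0t : x o0 <= t := le_trans (x0_le i) it.
(* Either no point from the leftmost one to [t] fails to move right, and the leftmost one serves, or
   [s] is a preimage of [t] taken after the last fixed point before [t]. Since [G] moves all of
   [[s, t]] to the right, the point found there is not fixed by [G]. *)
have [s [x0s st sGG s_up]] : exists s, [/\ x o0 <= s, s <= t, s <= G (G s) &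
    forall u, s <= u <= t -> u < G u].
  have [up|] := pselect (forall u, x o0 <= u <= t -> u < G u).
    by exists (x o0); split=> //; rewrite !Gx x0_le.
  move=> /existsNP[u /not_implyP[/andP[x0u ut] /negP]]; rewrite -leNgt => Gu.
  have [|z [/andP[uz zt] /eqP + z_last]] :=
      continuous_last_point (v := 0) GBid_cont ut.
    by rewrite Gt subr_le0 subr_ge0 Gu ltW.
  rewrite subr_eq0 => /eqP Gz.
  have [|s] := @IVT _ G z t t zt (continuous_subspaceT G_cont).
    by rewrite ge_min Gz zt le_max Gt (ltW tv) orbT.
  rewrite in_itv /= => /andP[zs st] Gs; exists s; split=> //.
  - exact: le_trans x0u (le_trans uz zs).
  - by rewrite Gs Gt (le_trans st (ltW tv)).
  - move=> y /andP[sy yt]; rewrite ltNge; apply/negP => Gy.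
    have yz : y <= z.
      by apply: z_last; rewrite ?subr_le0 // yt (le_trans uz) // (le_trans zs).
    have sz : s = z by apply/le_anti; rewrite zs (le_trans sy yz).
    have tz : t = z by rewrite -Gs sz Gz.
    by move: tv; rewrite -Gt tz Gz ltxx.
have GGBid_cont : continuous (fun u => G (G u) - u).
  move=> u; apply: cvgB; last exact: cvg_id.
  by apply: continuous_comp; exact: G_cont.
have [|z] := @IVT _ (fun u => G (G u) - u) s t 0 st (continuous_subspaceT GGBid_cont).
  by rewrite Gt Gv ge_min le_max !subr_le0 !subr_ge0 x0t sGG orbT.
rewrite in_itv /= => szt /eqP; rewrite subr_eq0 => /eqP GGz.
exists z; split=> //; last exact: s_up.
have := x_in o0; have := x_in iv; rewrite !in_itv /= => /andP[_ vhi] /andP[xlo _].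
have /andP[sz zt] := szt.
by rewrite (le_trans xlo (le_trans x0s sz)) (le_trans zt (le_trans (ltW tv) vhi)).
Qed.

Lemma two_cycle_forced (R : realType) (p : pattern) :
  (1 < period p)%N -> forces R p two_cycle.
Proof.
move=> p_gt1 lo hi g [lohi g_cont g_in] [P [_ P_sub _ _] P_exhibits].
have [G G_cont Gg] := continuous_extension (ltW lohi) g_cont.
have [||z [z_in zG GGz]] := @two_cycle_orbit R lo hi G p P G_cont _ p_gt1 P_sub.
- by move=> x x_in; rewrite Gg // g_in.
- have [cardP gP] := P_exhibits; split=> // i; rewrite Gg //.
  by apply: P_sub; rewrite -mem_points mem_nth // size_points cardP.
have Gz_in : G z \in `[lo, hi] by rewrite Gg // g_in.
have [||| Q []] := @exhibits_orbit R lo hi g two_cycle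
    (fun k : 'I_2 => if k == ord0 then z else G z).
- by move=> [[|[|i]] i2] [[|[|j]] j2].
- by move=> i; case: ifP.
- have vE (k : 'I_2) : two_cycle k = (if k == 0%N :> nat then 1 else 0)%N :> nat.
    by rewrite [LHS](val_rotation_perm two_cycle_bounds) //; case: k => [[|[|k]] k2].
  move=> k; have := vE k; rewrite -!(inj_eq val_inj) /= => ->.
  by case: k => [[|[|k]] k2] //=; rewrite -Gg.
by exists Q.
Qed.

(** * Flipped rotations as interval exchanges *)

Section RotationIET.
Variable R : realType.

(* The rotation by bt of a circle of length 1, conjugated by the reversal of
   its arc [al, 1). *)
Definition flipped_rotation (al bt t : R) : R :=
  if t < al - bt then t + bt else if t < al then 1 + al - bt - t
  else if t < al + bt then al + bt - t else t - bt.

Variables (al bt : R).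
Hypothesis arcs : 0 < bt /\ bt <= al <= 1 - bt.

Lemma flipped_rotation_in : {in `[0, 1], forall t, flipped_rotation al bt t \in `[0, 1]}.
Proof.
have [bt_gt0 /andP[le_btal le_al]] := arcs.
suff T_in (t : R) : 0 <= t <= 1 -> 0 <= flipped_rotation al bt t <= 1.
  by move=> t; rewrite !in_itv; exact: T_in.
rewrite /flipped_rotation => /andP[t0 t1].
by case: (ltP t (al - bt)) => h1; [|case: (ltP t al) => h2; [|case: (ltP t (al + bt)) => h3]];
  apply/andP; split; lra.
Qed.

Lemma flipped_rotation1 t : t < al - bt -> flipped_rotation al bt t = t + bt.
Proof. by rewrite /flipped_rotation => ->. Qed.

Lemma flipped_rotation2 t :
  al - bt <= t < al -> flipped_rotation al bt t = 1 + al - bt - t.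
Proof. by rewrite /flipped_rotation => /andP[at_ ->]; rewrite ltNge at_. Qed.

Lemma flipped_rotation3 t :
  al <= t < al + bt -> flipped_rotation al bt t = al + bt - t.
Proof.
have [bt_gt0 _] := arcs; rewrite /flipped_rotation => /andP[at_ ->].
rewrite [t < al]ltNge at_ /= ltNge (le_trans _ at_) //=.
by rewrite lerBlDr lerDl ltW.
Qed.

Lemma flipped_rotation4 t : al + bt <= t -> flipped_rotation al bt t = t - bt.
Proof.
have [bt_gt0 _] := arcs; rewrite /flipped_rotation => at_.
have le_al_t : al <= t by apply: le_trans at_; rewrite lerDl ltW.
rewrite [t < al + bt]ltNge at_ [t < al]ltNge le_al_t /=.
by rewrite ltNge (le_trans _ le_al_t) //= lerBlDr lerDl ltW.
Qed.

Lemma flipped_rotation_inj (S : set R) :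
  (forall t, S t -> [/\ 0 < t < 1, t != al - bt, t != al & t != al + bt]) ->
  set_inj S (flipped_rotation al bt).
Proof.
have [bt_gt0 /andP[le_btal le_al]] := arcs.
(* The images of the four pieces follow each other in the order third, first, fourth, second; [inv]
   undoes the map on each. *)
pose inv v := if v < bt then al + bt - v else if v < al then v - bt
  else if v <= 1 - bt then v + bt else 1 + al - bt - v.
move=> SP; apply: (@can_in_inj _ _ _ _ inv) => t.
rewrite inE => /SP[/andP[t0 t1] ta tb tc].
have [t_lt|] := ltP t (al - bt).
  by rewrite flipped_rotation1 // /inv ifF ?ifT; lra.
rewrite le_eqVlt eq_sym (negPf ta) /= => lt_t.
have [t_lt|] := ltP t al.
  rewrite flipped_rotation2; last by rewrite ltW.
  by rewrite /inv ifF ?ifF ?ifF; lra.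
rewrite le_eqVlt eq_sym (negPf tb) /= => {}lt_t.
have [t_lt|] := ltP t (al + bt).
  rewrite flipped_rotation3; last by rewrite ltW.
  by rewrite /inv ifT; lra.
rewrite le_eqVlt eq_sym (negPf tc) /= => {}lt_t.
rewrite flipped_rotation4 ?ltW //.
by rewrite /inv ifF 1?ifF 1?ifT; lra.
Qed.

Lemma flipped_rotation_IET (n k : nat) (x : nat -> R) (F : {set 'I_n}) :
  subdivision n x -> #|F| = k ->
  (forall v, v = al - bt \/ v = al \/ v = al + bt -> exists2 i, (i <= n)%N & x i = v) ->
  (forall j : 'I_n, exists c, forall t : R, x j <= t < x j.+1 ->
    flipped_rotation al bt t = (-1) ^+ (j \in F) * t + c) ->
  IET n k (flipped_rotation al bt).
Proof.
move=> x_sub cardF x_cut /fin_all_exists[c cP].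
split; first exact: flipped_rotation_in.
have [x0 xn _] := x_sub.
exists x, F, c; split=> //.
apply: flipped_rotation_inj => t -[/= t01 tx].
have t_neq v : (exists2 i, (i <= n)%N & x i = v) -> t != v.
  by move=> [i i_le <-]; apply/eqP => tv; apply: tx; exists i; rewrite /= ?ltnS.
split; try by apply: t_neq; apply: x_cut; tauto.
rewrite in_itv /= in t01; have /andP[t0 t1] := t01.
rewrite !lt_neqAle t0 t1 !andbT eq_sym !t_neq //; first by exists n.
by exists 0%N.
Qed.

(** When [al] is [bt] or [1 - bt], a piece of slope +1 degenerates and three intervals remain. The
    other piece of slope +1, nonempty because [2 * bt < 1], is then cut at its midpoint [mid] to
    obtain exactly four. *)
Lemma flipped_rotation_IET42 : 2 * bt < 1 -> IET 4 2 (flipped_rotation al bt).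
Proof.
have [bt_gt0 /andP[le_btal le_al]] := arcs.
move=> lt2bt.
have [bt_lt|al_le] := ltP bt al; last first.
  have alE : al = bt by lra.
  pose mid := (1 + 2 * bt) / 2.
  apply: (@flipped_rotation_IET 4 2 (nth 0 [:: 0; bt; 2 * bt; mid; 1])
     [set (@Ordinal 4 0 isT); (@Ordinal 4 1 isT)]%SET).
  - by split=> // -[|[|[|[|i]]]] //= _; rewrite /mid; lra.
  - by rewrite cards2.
  - by move=> v [|[]] ->; [exists 0%N|exists 1%N|exists 2%N] => //=; lra.
  - move=> [[|[|[|[|j]]]] j4] //=; rewrite !inE /=.
    + exists 1 => t /andP[? ?]; rewrite expr1 flipped_rotation2; lra.
    + exists (2 * bt) => t /andP[? ?]; rewrite expr1 flipped_rotation3; lra.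
    + exists (- bt) => t /andP[+ +]; rewrite /mid => ? ?;
      rewrite expr0 flipped_rotation4; lra.
    + exists (- bt) => t /andP[+ +]; rewrite /mid => ? ?;
      rewrite expr0 flipped_rotation4; lra.
have [al_lt|le_al'] := ltP al (1 - bt); last first.
  have alE : al = 1 - bt by lra.
  pose mid := (al - bt) / 2.
  apply: (@flipped_rotation_IET 4 2 (nth 0 [:: 0; mid; al - bt; al; 1])
     [set (@Ordinal 4 2 isT); (@Ordinal 4 3 isT)]%SET).
  - by split=> // -[|[|[|[|i]]]] //= _; rewrite /mid; lra.
  - by rewrite cards2.
  - by move=> v [|[]] ->; [exists 2%N|exists 3%N|exists 4%N] => //=; lra.
  - move=> [[|[|[|[|j]]]] j4] //=; rewrite !inE /=.
    + exists bt => t /andP[+ +]; rewrite /mid => ? ?;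
      rewrite expr0 flipped_rotation1; lra.
    + exists bt => t /andP[+ +]; rewrite /mid => ? ?;
      rewrite expr0 flipped_rotation1; lra.
    + exists (1 + al - bt) => t /andP[? ?]; rewrite expr1 flipped_rotation2; lra.
    + exists (al + bt) => t /andP[? ?]; rewrite expr1 flipped_rotation3; lra.
apply: (@flipped_rotation_IET 4 2 (nth 0 [:: 0; al - bt; al; al + bt; 1])
   [set (@Ordinal 4 1 isT); (@Ordinal 4 2 isT)]%SET).
- by split=> // -[|[|[|[|i]]]] //= _; lra.
- by rewrite cards2.
- by move=> v [|[]] ->; [exists 1%N|exists 2%N|exists 3%N].
- move=> [[|[|[|[|j]]]] j4] //=; rewrite !inE /=.
  + exists bt => t /andP[? ?]; rewrite expr0 flipped_rotation1; lra.
  + exists (1 + al - bt) => t /andP[? ?]; rewrite expr1 flipped_rotation2; lra.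
  + exists (al + bt) => t /andP[? ?]; rewrite expr1 flipped_rotation3; lra.
  + exists (- bt) => t /andP[? ?]; rewrite expr0 flipped_rotation4; lra.
Qed.

Lemma flipped_rotation_IET32 : 2 * bt < 1 -> al = bt \/ al = 1 - bt ->
  IET 3 2 (flipped_rotation al bt).
Proof.
have [bt_gt0 /andP[le_btal le_al]] := arcs.
move=> lt2bt [alE|alE].
  apply: (@flipped_rotation_IET 3 2 (nth 0 [:: 0; bt; 2 * bt; 1])
     [set (@Ordinal 3 0 isT); (@Ordinal 3 1 isT)]%SET).
  - by split=> // -[|[|[|i]]] //= _; lra.
  - by rewrite cards2.
  - by move=> v [|[]] ->; [exists 0%N|exists 1%N|exists 2%N] => //=; lra.
  - move=> [[|[|[|j]]] j3] //=; rewrite !inE /=.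
    + exists 1 => t /andP[? ?]; rewrite expr1 flipped_rotation2; lra.
    + exists (2 * bt) => t /andP[? ?]; rewrite expr1 flipped_rotation3; lra.
    + exists (- bt) => t /andP[? ?]; rewrite expr0 flipped_rotation4; lra.
apply: (@flipped_rotation_IET 3 2 (nth 0 [:: 0; al - bt; al; 1])
   [set (@Ordinal 3 1 isT); (@Ordinal 3 2 isT)]%SET).
- by split=> // -[|[|[|i]]] //= _; lra.
- by rewrite cards2.
- by move=> v [|[]] ->; [exists 1%N|exists 2%N|exists 3%N] => //=; lra.
- move=> [[|[|[|j]]] j3] //=; rewrite !inE /=.
  + exists bt => t /andP[? ?]; rewrite expr0 flipped_rotation1; lra.
  + exists (1 + al - bt) => t /andP[? ?]; rewrite expr1 flipped_rotation2; lra.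
  + exists (al + bt) => t /andP[? ?]; rewrite expr1 flipped_rotation3; lra.
Qed.

End RotationIET.

(** The points are the centres of the [q] cells of length [1 / q]. The shift by one half keeps them
    off the cuts, which are multiples of [1 / q], so real comparisons become comparisons of
    indices. *)
Lemma flipped_rotation_midpoint (R : realType) (q b A : nat)
    (b_gt0 : (0 < b)%N) (cobq : coprime b q) (leAq : (b <= A <= q - b)%N)
    (k : 'I_q) :
  flipped_rotation (A%:R / q%:R) (b%:R / q%:R) ((k%:R + 2^-1) / q%:R) =
  ((rotation_perm q b A k)%:R + 2^-1) / q%:R :> R.
Proof.
have [bA Aqb] := andP leAq.
have kq := ltn_ord k; have q_gt0 : (0 < q)%N by lia.
have q_gt0' : 0 < (q%:R : R)^-1 by rewrite invr_gt0 ltr0n.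
have q_neq0 : q%:R != 0 :> R by rewrite pnatr_eq0 -lt0n.
have ltE (m : nat) (u : R) : u = m%:R -> ((k%:R + 2^-1 < u) = (k < m)%N).
  move=> ->; apply/idP/idP => [|km].
    by apply: contraTT; rewrite -leqNgt -leNgt -(ler_nat R) => mk; lra.
  have : k.+1%:R <= m%:R :> R by rewrite ler_nat.
  by rewrite -natr1 => ?; lra.
rewrite /flipped_rotation -!mulrBl -!mulrDl !ltr_pM2r // val_rotation_perm //.
rewrite (ltE (A - b)%N) ?natrB // (ltE A) // (ltE (A + b)%N) ?natrD //.
case: ifP => k1; first by rewrite natrD; field.
case: ifP => k2.
  have -> : (q.-1 + A - b - k = q + A - (b + k.+1))%N by lia.
  rewrite natrB; last by lia.
  by rewrite !natrD -natr1; field.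
case: ifP => k3.
  have -> : (A + b - 1 - k = A + b - k.+1)%N by lia.
  rewrite natrB; last by lia.
  by rewrite natrD -natr1; field.
by rewrite natrB; [field|lia].
Qed.

(** * From laps of a map to its pattern *)

Section RealLaps.
Variables (R : realType) (f : R -> R).

(** The direction is a boolean, so that alternation of laps is a negation. The case [u = v] holds in
    both directions and stands for a missing lap. *)
Definition homo_on (up : bool) (u v : R) : Prop :=
  forall s t, u <= s -> s <= t -> t <= v -> if up then f s <= f t else f t <= f s.

Lemma homo_on_point up u : homo_on up u u.
Proof.
move=> s t us st tu; have -> : s = t by apply/le_anti; rewrite st (le_trans tu us).
by rewrite lexx if_same.
Qed.

Lemma homo_on_cat up u v w : homo_on up u v -> homo_on up v w -> homo_on up u w.
Proof.
move=> uv vw s t us st tw.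
have [tv|/ltW vt] := leP t v; first exact: uv.
have [vs|/ltW sv] := leP v s; first exact: vw.
have := uv s v us sv (lexx v); have := vw v t (lexx v) vt tw.
by case: up {uv vw} => h1 h2; [apply: le_trans h2 h1|apply: le_trans h1 h2].
Qed.

Lemma monotone_on_homo u v : monotone_on f `[u, v] -> exists up, homo_on up u v.
Proof.
case=> mono; [exists true|exists false] => s t us st tv; apply: mono => //;
  by rewrite inE /= in_itv /= ?us ?tv ?(le_trans us st) ?(le_trans st tv).
Qed.

Lemma two_pieces : piecewise_monotone f 2 -> exists up y,
  [/\ 0 <= y <= 1, homo_on up 0 y & homo_on (~~ up) y 1].
Proof.
move=> [x [x0 x2 x_incr] x_mono].
have [up0 m0] := monotone_on_homo (x_mono 0%N isT).
have [up1 m1] := monotone_on_homo (x_mono 1%N isT).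
have := x_incr 0%N isT; have := x_incr 1%N isT.
rewrite x0 x2 in m0 m1 * => /ltW h1 /ltW h0.
have [eq_up|] := eqVneq up0 up1.
  exists up0, 1; rewrite ler01 lexx; split=> //; last exact: homo_on_point.
  by apply: homo_on_cat m0 _; rewrite eq_up.
move=> neq_up; exists up0, (x 1%N); rewrite h0 h1; split=> //.
by have -> : ~~ up0 = up1 by case: up0 up1 neq_up {m0 m1} => [] [].
Qed.

(** Neighbouring pieces with the same direction are merged, and one-point laps at 1 restore their
    number, so the directions alternate. *)
Lemma three_pieces : piecewise_monotone f 3 -> exists up y1 y2,
  [/\ homo_on up 0 y1, homo_on (~~ up) y1 y2 & homo_on up y2 1].
Proof.
move=> [x [x0 x3 x_incr] x_mono].
have [up0 m0] := monotone_on_homo (x_mono 0%N isT).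
have [up1 m1] := monotone_on_homo (x_mono 1%N isT).
have [up2 m2] := monotone_on_homo (x_mono 2%N isT).
rewrite x0 x3 in m0 m2.
have [eq01|neq01] := eqVneq up0 up1.
  rewrite eq01 in m0; have m01 := homo_on_cat m0 m1.
  have [eq12|neq12] := eqVneq up1 up2.
    exists up1, 1, 1; split; last 2 first; try exact: homo_on_point.
    by apply: homo_on_cat m01 _; rewrite eq12.
  exists up1, (x 2%N), 1; split=> //; last exact: homo_on_point.
  by have -> : ~~ up1 = up2 by case: up1 up2 neq12 {m0 m1 m2 m01 eq01} => [] [].
have up01 : ~~ up0 = up1 by case: up0 up1 neq01 {m0 m1} => [] [].
have [eq12|neq12] := eqVneq up1 up2.
  exists up0, (x 1%N), 1; split=> //; last exact: homo_on_point.
  by rewrite up01; apply: homo_on_cat m1 _; rewrite eq12.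
exists up0, (x 1%N), (x 2%N); split=> //; first by rewrite up01.
by have -> : up0 = up2 by case: up0 up1 up2 up01 neq12 {m0 m1 m2 neq01} => [] [] [].
Qed.

(** A one-point lap at 1 or at 0 turns a unimodal map into an up-down-up one. *)
Lemma three_pieces_up y up : homo_on up 0 y -> homo_on (~~ up) y 1 ->
  exists y1 y2, [/\ homo_on true 0 y1, homo_on false y1 y2 & homo_on true y2 1].
Proof.
case: up => m0 m1.
  by exists y, 1; split=> //; exact: homo_on_point.
by exists 0, y; split=> //; exact: homo_on_point.
Qed.

Lemma homo_on_three_laps (P : {fset R}) (p : pattern) (up : bool) (y1 y2 : R) :
  {subset P <= `[0, 1]} -> exhibits f P p ->
  homo_on up 0 y1 -> homo_on (~~ up) y1 y2 -> homo_on up y2 1 ->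
  three_laps p up (fun i => (points P)`_i <= y1) (fun i => y2 <= (points P)`_i).
Proof.
move=> P_sub [cardP fP] m1 m2 m3.
pose x (i : 'I_(period p)) : R := (points P)`_i.
have x_le i j : (x i <= x j) = (i <= j)%N by rewrite nth_points_le ?cardP.
have x_in i : 0 <= x i <= 1.
  suff : x i \in `[0, 1] by rewrite in_itv.
  by apply: P_sub; rewrite -mem_points mem_nth // size_points cardP.
have x_ge0 i : 0 <= x i by case/andP: (x_in i).
have x_le1 i : x i <= 1 by case/andP: (x_in i).
split=> i j; rewrite -/(x i) -/(x j).
- by rewrite -x_le; exact: le_trans.
- by rewrite -x_le => ij yi; exact: le_trans ij.
- move=> _ xj; rewrite -x_le => ij.
  by have := m1 _ _ (x_ge0 i) ij xj; rewrite !fP -/(x _) -/(x _) !x_le.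
- rewrite -!ltNge => /ltW xi /ltW xj; rewrite -x_le => ij.
  by have := m2 _ _ xi ij xj; rewrite !fP -/(x _) -/(x _) !x_le; case: (up).
- move=> xi _; rewrite -x_le => ij.
  by have := m3 _ _ xi ij (x_le1 j); rewrite !fP -/(x _) -/(x _) !x_le.
Qed.

End RealLaps.

(** * Rotation patterns of cycles with at most three laps *)

Lemma over_rotation_fraction (p : pattern) : (1 < period p)%N ->
  exists b q, [/\ (0 < b)%N, coprime b q, (2 * b <= q)%N &
    pattern_over_rotation p = b%:R / q%:R].
Proof.
move=> p_gt1; rewrite /pattern_over_rotation; set S := [set i | _]%SET.
have n_gt0 := period_gt0 p.
have S_gt0 : (0 < #|S|)%N.
  (* Without a change of direction every point would move right like the first one, which the last
     point cannot do. *)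
  rewrite card_gt0; apply/eqP => S0.
  have lastn : ((period p).-1 < period p)%N by rewrite ltn_predL.
  have up_closed (k : 'I_(period p)) : (k < p k)%N -> (p k < p (p k))%N.
    have : k \notin S by rewrite S0 finset.in_set0.
    by rewrite inE negbK => /eqP ->.
  have up0 : (Ordinal n_gt0 < p (Ordinal n_gt0))%N.
    have := pattern_not_fixed (Ordinal n_gt0) p_gt1.
    by rewrite -(inj_eq val_inj) /= lt0n.
  have := @pattern_closed p (fun i => i < p i)%N _ (Ordinal lastn) up_closed up0.
  by have := ltn_ord (p (Ordinal lastn)); rewrite /=; lia.
have S_le : (#|S| <= period p)%N by rewrite -[X in (_ <= X)%N]card_ord max_card.
pose d := gcdn #|S| (2 * period p).
have d_gt0 : (0 < d)%N by rewrite gcdn_gt0 S_gt0.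
have dS : (#|S| %/ d * d = #|S|)%N by rewrite divnK // dvdn_gcdl.
have dn : (2 * period p %/ d * d = 2 * period p)%N by rewrite divnK // dvdn_gcdr.
exists (#|S| %/ d)%N, (2 * period p %/ d)%N; split.
- by rewrite divn_gt0 // dvdn_leq // dvdn_gcdl.
- by rewrite /coprime -(eqn_pmul2r d_gt0) muln_gcdl dS dn mul1n.
- by rewrite -(leq_pmul2r d_gt0) -mulnA dS dn leq_mul2l.
- have d_neq0 : d%:R != 0 :> rat by rewrite pnatr_eq0 -lt0n.
  by rewrite -[in LHS]dS -[in LHS]dn !natrM -mulf_div divff // mulr1.
Qed.

(** The phases determine [A] when all points after one moving left also move left. In the remaining
    down-up-down case the two horseshoes give [A = b] and [A = q - b]. *)
Lemma three_laps_forced (R : realType) (p : pattern) (up : bool)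
    (L1 L3 : pred 'I_(period p)) (b q : nat)
    (b_gt0 : (0 < b)%N) (cobq : coprime b q) :
  (2 < period p)%N -> (2 * b < q)%N -> pattern_over_rotation p = b%:R / q%:R ->
  three_laps p up L1 L3 ->
  exists A (leAq : (b <= A <= q - b)%N),
    forces R p (rotation_pattern b_gt0 cobq leAq).
Proof.
move=> n_gt2 lt2b rho laps; have n_gt1 := ltnW n_gt2.
have from_shape : (exists s d1 d2, convergent_shape p s d1 d2) ->
    exists A (leAq : (b <= A <= q - b)%N),
      forces R p (rotation_pattern b_gt0 cobq leAq).
  move=> [s [d1 [d2 shape]]].
  have [A [e [s' [leAq cover]]]] := shape_cover b_gt0 lt2b shape rho.
  by exists A, leAq; exact: cover_forces cover.
case: up laps => laps; first exact/from_shape/(up_down_up_shape n_gt1 laps).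
have [conv|] := pselect (forall i j : 'I_(period p), (i < j)%N -> (p i < i)%N -> (p j < j)%N).
  exact/from_shape/(down_up_down_convergent n_gt1 n_gt2 laps).
move=> /existsNP[i /existsNP[j /not_implyP[ij /not_implyP[pi /negP pj]]]].
have {}pj : (j < p j)%N.
  have := pattern_not_fixed j n_gt1; rewrite -(inj_eq val_inj) /=; lia.
have [[d1 [d2 [r [d12 rp pd2 rpr]]]]|[l [d1 [d2 [ld12 pll d2p pd2]]]]] :=
    down_up_down_divergent n_gt1 n_gt2 laps ij pi pj.
  have [e cover] := horseshoe_cover lt2b d12 rp pd2 rpr.
  have leAq : (b <= b <= q - b)%N by lia.
  by exists b, leAq; exact: cover_forces cover.
have [e cover] := mirror_horseshoe_cover lt2b ld12 pll d2p pd2.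
have leAq : (b <= q - b <= q - b)%N by lia.
by exists (q - b)%N, leAq; exact: cover_forces cover.
Qed.

(** For [A] strictly between the bounds, the maximum is attained at index [A - b] and the minimum at
    [A + b - 1], neither of them an end. But an up-down map has its minimum over the cycle at an
    end, and a down-up map its maximum. *)
Lemma rotation_two_pieces (R : realType) (f : R -> R) (P : {fset R}) (q b A : nat)
    (b_gt0 : (0 < b)%N) (cobq : coprime b q) (leAq : (b <= A <= q - b)%N) :
  {subset P <= `[0, 1]} -> exhibits f P (rotation_pattern b_gt0 cobq leAq) ->
  piecewise_monotone f 2 -> A = b \/ A = (q - b)%N.
Proof.
move=> P_sub [cardP fP] /two_pieces[up [y [/andP[y0 y1] m0 m1]]].
have [->|Ab] := eqVneq A b; first by left.
have [->|Aqb] := eqVneq A (q - b)%N; first by right.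
exfalso; pose x (i : 'I_q) : R := (points P)`_i.
have x_le i j : (x i <= x j) = (i <= j)%N by rewrite nth_points_le ?cardP.
have fx i : f (x i) = x (rotation_perm q b A i) := fP i.
have x_in i : 0 <= x i <= 1.
  suff : x i \in `[0, 1] by rewrite in_itv.
  by apply: P_sub; rewrite -mem_points mem_nth // size_points cardP.
have perm_inj' i j : rotation_perm q b A i = rotation_perm q b A j :> nat -> i = j :> nat.
  by move=> /val_inj/perm_inj ->.
have c1q : (A - b < q)%N by lia.
have c2q : (A + b - 1 < q)%N by lia.
have q_gt0 : (0 < q)%N by lia.
have lq : (q.-1 < q)%N by lia.
have pc1 : rotation_perm q b A (Ordinal c1q) = q.-1 :> nat.
  by rewrite val_rotation_perm //= ltnn; case: ifP; lia.
have pc2 : rotation_perm q b A (Ordinal c2q) = 0%N :> nat.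
  by rewrite val_rotation_perm //=; do ![case: ifP => ?]; lia.
have no_min (i : 'I_q) : i != (A + b - 1)%N :> nat ->
    ~~ (x (rotation_perm q b A i) <= x (rotation_perm q b A (Ordinal c2q))).
  move=> i_neq; rewrite x_le pc2 leqn0; apply: contra i_neq => /eqP pi0.
  by apply/eqP; apply: (perm_inj' i (Ordinal c2q)); rewrite pc2.
have no_max (i : 'I_q) : i != (A - b)%N :> nat ->
    ~~ (x (rotation_perm q b A (Ordinal c1q)) <= x (rotation_perm q b A i)).
  move=> i_neq; rewrite x_le pc1; apply: contra i_neq => pi.
  apply/eqP; apply: (perm_inj' i (Ordinal c1q)); rewrite pc1.
  by have := ltn_ord (rotation_perm q b A i); lia.
have /andP[x00 _] := x_in (Ordinal q_gt0).
have /andP[_ xl1] := x_in (Ordinal lq).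
case: up m0 m1 => m0 m1.
  have [x_y|/ltW y_x] := leP (x (Ordinal c2q)) y.
    have := m0 _ _ x00 _ x_y; rewrite x_le !fx => /(_ isT).
    by apply/negP/no_min; rewrite /=; lia.
  have := m1 _ _ y_x _ xl1; rewrite x_le !fx.
  have lec2 : (Ordinal c2q <= Ordinal lq)%N by rewrite /=; lia.
  by move=> /(_ lec2); apply/negP/no_min; rewrite /=; lia.
have [x_y|/ltW y_x] := leP (x (Ordinal c1q)) y.
  have := m0 _ _ x00 _ x_y; rewrite x_le !fx => /(_ isT).
  by apply/negP/no_max; rewrite /=; lia.
have := m1 _ _ y_x _ xl1; rewrite x_le !fx.
have lec1 : (Ordinal c1q <= Ordinal lq)%N by rewrite /=; lia.
by move=> /(_ lec1); apply/negP/no_max; rewrite /=; lia.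
Qed.

(** Both cycles exhibit the same pattern, so matching points of equal rank is a conjugacy. *)
Lemma rotation_conjugate (R : realType) (f : R -> R) (P : {fset R}) (q b A : nat)
    (b_gt0 : (0 < b)%N) (cobq : coprime b q) (leAq : (b <= A <= q - b)%N)
    (T := flipped_rotation (A%:R / q%:R) (b%:R / q%:R)) :
  exhibits f P (rotation_pattern b_gt0 cobq leAq) ->
  exists Q : {fset R}, periodic_orbit 0 1 T Q /\ conjugate_on f P T Q.
Proof.
move=> [cardP fP]; have q_gt0 : (0 < q)%N by lia.
have q_gt0' : 0 < (q%:R : R)^-1 by rewrite invr_gt0 ltr0n.
pose y (k : nat) : R := (k%:R + 2^-1) / q%:R.
have y_le i j : (y i <= y j) = (i <= j)%N by rewrite ler_pM2r // lerD2r ler_nat.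
have [||| Q [Q_orbit _ Q_range]] := @exhibits_orbit R 0 1 T
    (rotation_pattern b_gt0 cobq leAq) (fun k => y k).
- by move=> i j ij; rewrite ltNge y_le -ltnNge.
- move=> i; rewrite in_itv /= /y divr_ge0 ?addr_ge0 ?ler0n ?invr_ge0 //=.
  rewrite ler_pdivrMr ?ltr0n // mul1r.
  have : i.+1%:R <= q%:R :> R by rewrite ler_nat; exact: ltn_ord.
  by rewrite -natr1 => ?; lra.
- by move=> i; exact: flipped_rotation_midpoint.
exists Q; split=> //; pose psi (u : R) := y (index u (points P)).
have psi_x (i : 'I_q) : psi (points P)`_i = y i.
  by rewrite /psi index_uniq ?size_points ?cardP ?ltn_ord // sort_uniq fset_uniq.
have PE u : u \in P -> exists i : 'I_q, u = (points P)`_i.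
  rewrite -mem_points => uP.
  have iq : (index u (points P) < q)%N by rewrite -[q]cardP -size_points index_mem.
  by exists (Ordinal iq); rewrite /= nth_index.
have QE v : v \in Q <-> range (fun k : 'I_q => y k) v by rewrite -Q_range.
exists psi; split.
- split.
  + by move=> u /= /PE[i ->]; rewrite psi_x; apply/QE; exists i.
  + move=> u v; rewrite !inE /= => /PE[i ->] /PE[j ->]; rewrite !psi_x => yij.
    suff -> : i = j by [].
    by apply/val_inj/eqP; rewrite eqn_leq -!y_le yij lexx.
  + move=> _ /= /QE[i _ <-]; exists (points P)`_i; last exact: psi_x.
    by rewrite /= -mem_points mem_nth // size_points cardP ltn_ord.
- move=> u v /PE[i ->] /PE[j ->]; rewrite !psi_x y_le => xij.
  by rewrite -(nth_points_le (P := P)) // cardP; exact: ltn_ord.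
- move=> u /PE[i ->]; rewrite fP psi_x [RHS]flipped_rotation_midpoint //.
  exact: psi_x.
Qed.

Lemma two_points_monotone (R : realType) (g f : R -> R) (P : {fset R}) :
  0 \in P -> 1 \in P -> #|` P| = 2%N -> P_linear g P f -> piecewise_monotone f 1.
Proof.
move=> P0 P1 cardP [_ f_lin].
have P_01 z : z \in P -> ~~ (0 < z < 1).
  move=> zP; apply/negP => /andP[z0 z1].
  have : (size [:: 0%R; z; 1%R] <= size (enum_fset P))%N.
    apply: uniq_leq_size.
      by rewrite /= !inE !negb_or (lt_eqF z0) (lt_eqF z1) lt_eqF ?ltr01.
    by move=> u; rewrite !inE => /or3P[] /eqP ->.
  by rewrite cardP.
exists (fun i => i%:R); first by split=> // -[].
case=> // _.
have fE t : 0 <= t <= 1 -> f t = (1 - t) * f 0 + t * f 1.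
  move=> t01; rewrite -f_lin ?ltr01 ?in_itv //.
  by rewrite mulr0 add0r mulr1.
have [f01|/ltW f10] := leP (f 0) (f 1); [left|right] => s t;
  rewrite !inE /= !in_itv /= => s01 t01 st; rewrite (fE s) // (fE t) // -subr_ge0.
  have -> : (1 - t) * f 0 + t * f 1 - ((1 - s) * f 0 + s * f 1) =
    (t - s) * (f 1 - f 0) by ring.
  by rewrite mulr_ge0 // subr_ge0.
have -> : (1 - t) * f 0 + t * f 1 - ((1 - s) * f 0 + s * f 1) =
  (s - t) * (f 0 - f 1) by ring.
by rewrite mulr_ge0 // subr_ge0.
Qed.

Theorem theorem3p13 (R : realType) (m : nat) (p : pattern) (a b : R)
    (g f : R -> R) (P : {fset R})
    (m12 : m = 1%N \/ m = 2%N)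
    (g_map : interval_map a b g)
    (P_orbit : periodic_orbit a b g P)
    (P_exhibits : exhibits g P p)
    (p_over_twist : over_twist R p)
    (P_left : 0 \in P) (P_right : 1 \in P) (P_sub : {subset P <= `[0, 1]})
    (f_linear : P_linear g P f)
    (f_modality : modality f m) :
  (m = 2%N -> exists (T : R -> R) (Q : {fset R}),
     [/\ IET 4 2 T, periodic_orbit 0 1 T Q & conjugate_on f P T Q]) /\
  (m = 1%N -> exists (T : R -> R) (Q : {fset R}),
     [/\ IET 3 2 T, periodic_orbit 0 1 T Q & conjugate_on f P T Q]).
Proof.
have [n_gt1 over_twist_p] := p_over_twist.
have fP : exhibits f P p.
  have [cardP gP] := P_exhibits; split=> // i; have [fg _] := f_linear.
  by rewrite fg // -mem_points mem_nth // size_points cardP.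
(* A cycle of two points has an affine linear map with a single lap, against a modality of 1 or
   2. *)
have n_neq2 : period p != 2%N.
  apply/eqP => n2; have [_ /(_ 1%N)] := f_modality.
  have cardP : #|` P| = 2%N by case: P_exhibits => ->.
  move/(_ (two_points_monotone P_left P_right cardP f_linear)).
  by case: m12 => ->.
have n_gt2 : (2 < period p)%N by rewrite ltn_neqAle eq_sym n_neq2.
have [d [q [d_gt0 codq le2d rho]]] := over_rotation_fraction n_gt1.
(* If [2 * d = q], coprimality gives [d = 1]; the forced cycle of period 2 has the same
   over-rotation number, so [p] would be of period 2. *)
have lt2d : (2 * d < q)%N.
  rewrite ltn_neqAle le2d andbT; apply/eqP => q2; move: n_neq2.
  have d1 : d = 1%N by move: codq; rewrite -q2 /coprime gcdnMl => /eqP.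
  rewrite -(over_twist_p two_cycle) //; first exact: two_cycle_forced.
  by rewrite rotation_over_rotation rho -q2 d1.
have [up [L1 [L3 laps]]] : exists up L1 L3, three_laps p up L1 L3.
  have [f_pieces _] := f_modality.
  case: m12 f_pieces => -> f_pieces.
    have [up [y [_ m0 m1]]] := two_pieces f_pieces.
    have [y1 [y2 [m1' m2' m3']]] := three_pieces_up m0 m1.
    by exists true; do 2!eexists; exact: homo_on_three_laps fP m1' m2' m3'.
  have [up [y1 [y2 [m1 m2 m3]]]] := three_pieces f_pieces.
  by exists up; do 2!eexists; exact: homo_on_three_laps fP m1 m2 m3.
have [A [leAq p_forces]] := three_laps_forced R d_gt0 codq n_gt2 lt2d rho laps.
have pE : rotation_pattern d_gt0 codq leAq = p.
  by apply: over_twist_p => //=; [lia|rewrite rotation_over_rotation].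
rewrite -pE in fP.
have [Q [Q_orbit fQ]] := rotation_conjugate fP.
have [q_gt0 dR] : 0 < q%:R :> R /\ 0 < d%:R :> R by rewrite !ltr0n; lia.
have [dA Aqd] := andP leAq.
pose al : R := A%:R / q%:R; pose bt : R := d%:R / q%:R.
have arcs : 0 < bt /\ bt <= al <= 1 - bt.
  rewrite /al /bt divr_gt0 // ler_pM2r ?invr_gt0 // ler_nat dA.
  have -> : 1 - d%:R / q%:R = (q%:R - d%:R) / q%:R :> R.
    by rewrite mulrBl divff // lt0r_neq0.
  by rewrite ler_pM2r ?invr_gt0 // -natrB ?ler_nat //; lia.
have lt2bt : 2 * bt < 1.
  by rewrite mulrA ltr_pdivrMr // mul1r -natrM ltr_nat.
split=> m_eq; do 2!eexists; split; try exact: Q_orbit; try exact: fQ.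
  exact: flipped_rotation_IET42.
apply: flipped_rotation_IET32 => //.
have [f_pieces _] := f_modality; rewrite m_eq in f_pieces.
have [->|->] := rotation_two_pieces P_sub fP f_pieces; [by left|right].
by rewrite natrB ?mulrBl ?divff ?lt0r_neq0 //; lia.
Qed.
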